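(* Let $k\ge 2$ be a fixed integer, let $\alpha>1$ be a fixed irrational number of finite type $\tau<\infty$, and let $\beta$ be a fixed real number. Then for any constant $\varepsilon>0$ and all real $x\ge 1$, $$ \sum_{\substack{1\leq n\leq x\\ [\alpha n+\beta]\in\mathcal{Q}_{k}}}1\;-\;\frac{x}{\zeta(k)}\;\ll\; x^{k/(2k-1)+\varepsilon}+x^{1-1/(\tau+1)+\varepsilon}, $$ where $n$ runs over integers and the implied constant depends only on $\alpha$, $\varepsilon$, $k$ and $\beta$.
   Context: $\zeta$ is the Riemann zeta function. $[t]$ denotes the greatest integer not larger than $t$. $\mathcal{Q}_k$ denotes the set of positive $k$-free integers, i.e. the positive integers $q$ such that for positive integers $m$, $m^k\mid q$ implies $m=1$. $\|t\|$ denotes the distance from the real number $t$ to the nearest integer. The type $\tau$ of an irrational number $\alpha$ is $$\tau:=\sup\Big\{\theta\in\mathbb{R}:\ \liminf_{\substack{q\to\infty\\ q\in\mathbb{Z}^{+}}}q^{\theta}\,\|\alpha q\|=0\Big\},$$ and $\alpha$ is of finite type if $\tau<\infty$. The notation $f\ll g$ means $|f|\le Cg$ for some constant $C>0$ (the implied constant). *)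

(* Defs.v *)
From HB Require Import structures.
From mathcomp Require Import all_boot all_order all_algebra.
From mathcomp Require Import all_classical all_reals all_analysis.

Set Implicit Arguments.
Unset Strict Implicit.
Unset Printing Implicit Defensive.

Import Order.TTheory GRing.Theory Num.Theory.
Import numFieldNormedType.Exports.

Local Open Scope classical_set_scope.
Local Open Scope ring_scope.

(* The Dirichlet series of the Riemann zeta function: [riemannR s n] is
   1 / (n + 1) ^ s. Meaningful for s > 1 only, where the series converges. *)
Definition zeta (R : realType) (s : R) : R := limn (series (riemannR s)).

(* A set of integers (not of naturals), so that it can be tested on the floor
   of a possibly negative real number. *)
Definition kfree (k : nat) : set int :=
  [set q : int | 0 < q /\
    forall m : nat, (0 < m)%N -> (m%:Z ^+ k %| q)%Z -> m = 1%N].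

Definition dist_int (R : realType) (t : R) : R :=
  inf [set `|t - m%:~R| | m in [set: int]].

(* Both the supremum and the lower limits are taken in the extended reals.
   The term q = 0 of the sequence does not affect its lower limit. *)
Definition irr_type (R : realType) (alpha : R) : \bar R :=
  ereal_sup [set theta%:E | theta in [set theta : R |
    limn_einf (fun q : nat => (q%:R `^ theta * dist_int (alpha * q%:R))%:E)
      = 0%E]].

(* Main.v *)
(* The k-free indicator of [l] is the sum of [mu d] over [d ^ k %| l], and the
   multiples of [D] of the form [floor (alpha * n + beta)] are counted by a
   difference of two floor sums of slope [- D / alpha], so that only rational
   approximations of [D / alpha] matter. Over a block of length [q], with [a / q]
   a Dirichlet approximation of the slope, such a difference is within O(1) of
   its mean; iterating [M |-> M %% q] bounds the error for [M] multiples by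
   [V log M], unless some [q] with [q V D <= Y] makes [q D / alpha] closer than
   [1 / (q V)] to an integer. The finite type of [alpha] passes to [1 / alpha]
   and bounds the number of [l = q D] for which this happens; the divisor bound
   turns this into a count of the exceptional [D = d ^ k], summed over dyadic [V].
   Moduli [d > Y ^ (1 / (2 k - 1))] are estimated trivially. *)
Require Import Defs.
From HB Require Import structures.
From mathcomp Require Import all_boot all_order all_algebra.
From mathcomp Require Import all_classical all_reals all_analysis.
From mathcomp Require Import ring lra zify.

Set Implicit Arguments.
Unset Strict Implicit.
Unset Printing Implicit Defensive.

Import Order.TTheory GRing.Theory Num.Theory.
Import numFieldNormedType.Exports.

Local Open Scope classical_set_scope.
Local Open Scope ring_scope.

(** * Moebius function and divisors *)

(** Treating each modulus [D] by itself is too costly: passing from [alpha^-1] to [D / alpha] loses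
    a factor [D ^ th] in the Diophantine lower bound. On average nothing is lost: a modulus failing
    at level [V] costs about [V], and at most about [W / V] moduli fail, up to logarithms and the
    divisor bound, so all dyadic levels weigh the same, with [W = Y / H + z ^ k + H ^ th / c]. Here
    [z] is the cutoff for [d], and [H] is a free threshold between small and large denominators. The
    term [z ^ k] appears because, for [l = q * d ^ k] and [d <= z], closeness [1 / (q V)] is at most
    [z ^ k / (l V)], a condition on [l] alone. Balancing [z ^ k] against the trivial bound
    [Y / z ^ (k - 1)] for larger moduli gives [z ^ (2 k - 1) = Y] and the exponent [k / (2 k - 1)].
    Balancing [Y / H] against [H ^ th] gives [H ^ (th + 1) = Y] and the exponent [1 - 1 / (th + 1)].
    The type only yields lower bounds for [th > tau]; that loss, the logarithms and the divisor
    bound all go into [eps]. *)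

Lemma sum_multiples (V : nmodType) (p B : nat) (F : nat -> V) : (0 < p)%N ->
  \sum_(1 <= l < B.+1 | (p %| l)%N) F l = \sum_(1 <= m < (B %/ p).+1) F (p * m)%N.
Proof.
move=> p0; elim: B => [|B IH]; first by rewrite div0n !big_geq.
rewrite big_mkcond big_nat_recr//= -big_mkcond IH divnS//.
case: ifPn => [pB|_] /=; last by rewrite addr0.
rewrite add1n [in RHS]big_nat_recr//=; congr (_ + F _).
by have := divnS B p0; rewrite pB add1n => <-; rewrite mulnC divnK.
Qed.

Definition mu (n : nat) : int :=
  if all (fun p => logn p n == 1%N) (primes n) then (-1) ^+ size (primes n)
  else 0.

Lemma norm_mu_le1 n : `|mu n| <= 1.
Proof. by rewrite /mu; case: ifP; rewrite ?normr0 // normrX normrN1 expr1n. Qed.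

Lemma mu1 : mu 1 = 1.
Proof. by []. Qed.

Lemma mu_mul_prime p e : prime p -> (0 < e)%N ->
  mu (p * e) = if (p %| e)%N then 0 else - mu e.
Proof.
move=> pp e0; have p0 := prime_gt0 pp.
have pM : p \in primes (p * e) by rewrite mem_primes pp muln_gt0 p0 e0 dvdn_mulr.
case: ifPn => pe.
  rewrite /mu ifN//; apply/allPn; exists p => //.
  rewrite lognM// logn_prime// eqxx add1n eqSS -lt0n.
  by rewrite -pfactor_dvdn // expn1.
have pnp : p \notin primes e by rewrite mem_primes pp e0.
have P : perm_eq (primes (p * e)) (p :: primes e).
  apply: uniq_perm; rewrite /= ?primes_uniq ?pnp// => r.
  by rewrite primesM// (primes_prime pp) !inE.
rewrite /mu (perm_all _ P) (perm_size P) /= lognM// logn_prime// eqxx.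
have -> : logn p e = 0%N by apply/eqP; rewrite -leqn0 leqNgt -pfactor_dvdn // expn1.
rewrite /= (@eq_in_all _ _ (fun r => logn r e == 1%N)); last first.
  move=> r re; rewrite lognM// logn_prime//.
  have /negPf -> : r != p by apply: contraNneq pnp => <-.
  by rewrite add0n.
by case: ifP; rewrite ?oppr0// exprS mulN1r.
Qed.

(** For a prime [p] dividing [n], the divisors [p * m] with [m] prime to [p] cancel the divisors
    [m], and [mu] vanishes on the divisors [p * m] with [p] dividing [m]. *)
Lemma sum_mu_dvd (n B : nat) : (0 < n <= B)%N ->
  \sum_(1 <= d < B.+1 | (d %| n)%N) mu d = (n == 1%N)%:R.
Proof.
move=> /andP[n0 nB]; have [n1|n1] := eqVneq n 1%N.
  rewrite big_mkcond big_ltn; last by rewrite ltnS -n1.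
  rewrite n1 dvd1n mu1 big_nat_cond big1 ?addr0//.
  by move=> i /andP[/andP[i1 _] _]; rewrite dvdn1; case: eqP i1 => // ->.
have n1' : (1 < n)%N by rewrite ltn_neqAle eq_sym n1.
pose p := pdiv n; have pp : prime p := pdiv_prime n1'.
have p0 := prime_gt0 pp; have pn : (p %| n)%N := pdiv_dvd n.
rewrite (bigID (fun d => (p %| d)%N)) /=.
rewrite [X in X + _]big_mkcondl -[X in X + _]/(\sum_(1 <= i < B.+1 | (p %| i)%N) _).
rewrite (sum_multiples B (fun i => if (i %| n)%N then mu i else 0) p0).
rewrite (@big_nat_widen _ _ _ _ (B %/ p).+1 B.+1) ?ltnS ?leq_div//=.
rewrite [X in X + _](_ : _ = - \sum_(1 <= d < B.+1 | (d %| n)%N && ~~ (p %| d)%N) mu d).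
  by rewrite addNr.
rewrite -sumrN [LHS]big_mkcond [RHS]big_mkcond; apply: eq_big_nat => d /andP[d0 dB].
rewrite mu_mul_prime// ltnS leq_divRL //.
have [pd|pd] := boolP (p %| d)%N; first by rewrite andbF; case: ifP => // _; case: ifP.
have cpd : coprime p d by rewrite prime_coprime.
rewrite Gauss_dvd// pn /= andbT; case: ifP; case: ifP => // dn pdB.
exfalso; move/negP: pdB; apply; rewrite mulnC; apply: leq_trans nB.
by apply: dvdn_leq => //; rewrite Gauss_dvd ?pn.
Qed.

(** Take [r] maximal with [r ^ k] dividing [l]. If [d ^ k] divides [l], so does the [k]-th power of
    the lcm of [d] and [r]; by maximality this lcm is [r]. *)
Lemma max_kth_power_root k l : (0 < k)%N -> (0 < l)%N ->
  exists2 r, (0 < r)%N & forall d, (d ^ k %| l)%N = (d %| r)%N.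
Proof.
move=> k0 l0.
have ex : exists m, (0 < m)%N && (m ^ k %| l)%N by exists 1%N; rewrite exp1n dvd1n.
have ub m : (0 < m)%N && (m ^ k %| l)%N -> (m <= l)%N.
  move=> /andP[m0 /(dvdn_leq l0)]; apply: leq_trans.
  by rewrite -{1}(expn1 m) leq_pexp2l.
have [r /andP[r0 rl] rmax] := ex_maxnP ex ub.
exists r => // d; apply/idP/idP => [dl|dr]; last exact: dvdn_trans (dvdn_exp2r k dr) rl.
have d0 : (0 < d)%N.
  by case: d dl => //; rewrite exp0n// dvd0n => /eqP l00; rewrite l00 in l0.
pose g := gcdn d r; have g0 : (0 < g)%N by rewrite gcdn_gt0 d0.
have /dvdnP[d' d'E] : (g %| d)%N := dvdn_gcdl d r.
have /dvdnP[r' r'E] : (g %| r)%N := dvdn_gcdr d r.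
have cop : coprime d' r'.
  rewrite /coprime; apply/eqP.
  have : gcdn d r = (gcdn d' r' * g)%N by rewrite {1}d'E {1}r'E muln_gcdl.
  rewrite -/g -{1}(mul1n g) => /eqP; rewrite eqn_pmul2r// => /eqP <- //.
(* [d' * r] is the lcm of [d] and [r]. *)
have big_dvd : ((d' * r) ^ k %| l)%N.
  move: dl rl; rewrite d'E r'E !expnMn => dl /dvdnP[t tE].
  move: dl; rewrite tE; rewrite mulnA dvdn_pmul2r ?expn_gt0 ?g0//= => d't.
  rewrite mulnA dvdn_pmul2r ?expn_gt0 ?g0// dvdn_pmul2r; last first.
    by rewrite expn_gt0; case: (r') r'E r0 => // ->.
  by rewrite -(@Gauss_dvdl _ t (r' ^ k)) // coprimeXl// coprimeXr.
have d'0 : (0 < d')%N by case: (d') d'E d0 => // ->.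
have := rmax (d' * r)%N; rewrite muln_gt0 d'0 r0 big_dvd => /(_ isT).
rewrite -{2}(mul1n r) leq_pmul2r// => d'1.
have : d' = 1%N by apply/eqP; rewrite eqn_leq d'1.
by move=> d'1'; rewrite d'E d'1' mul1n dvdn_gcdr.
Qed.

(** The sum runs over the divisors of the maximal root [r], hence detects [r = 1]. The free bound
    [B] gives all [l] a common range for [d], so that the two summations can be exchanged later. *)
Lemma mem_kfreeE k l B : (0 < k)%N -> (0 < l <= B)%N ->
  ((l%:Z \in kfree k) : nat)%:R = \sum_(1 <= d < B.+1 | (d ^ k %| l)%N) mu d.
Proof.
move=> k0 /andP[l0 lB]; have [r r0 rE] := max_kth_power_root k0 l0.
have rl : (r <= B)%N.
  apply: leq_trans lB; apply: leq_trans (dvdn_leq l0 (_ : r ^ k %| l)%N); last by rewrite rE.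
  by rewrite -{1}(expn1 r) leq_pexp2l.
rewrite (eq_bigl (fun d => (d %| r)%N)); last by move=> d; exact: rE.
rewrite sum_mu_dvd ?r0//; congr ((nat_of_bool _)%:R).
have zE m : (m%:Z ^+ k %| l%:Z)%Z = (m ^ k %| l)%N.
  by rewrite dvdzE abszX !absz_nat.
apply/idP/eqP => [|r1].
  by rewrite inE => -[_ /(_ r r0)]; rewrite zE rE; apply.
rewrite inE; split=> // m m0; rewrite zE rE r1 dvdn1 => /eqP //.
Qed.

(** * Power bounds for the number of divisors and for the logarithm *)

Lemma size_divisors_pfactor p a m : prime p -> (0 < m)%N -> ~~ (p %| m)%N ->
  (size (divisors (p ^ a * m)) <= a.+1 * size (divisors m))%N.
Proof.
move=> pp m0 pm; have p0 := prime_gt0 pp.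
have n0 : (0 < p ^ a * m)%N by rewrite muln_gt0 expn_gt0 p0.
rewrite -(size_iota 0 a.+1) -(size_allpairs (fun i e => p ^ i * e)%N).
apply: uniq_leq_size; first exact: divisors_uniq.
move=> d; rewrite -dvdn_divisors// => dn.
have d0 : (0 < d)%N := dvdn_gt0 n0 dn.
apply/allpairsP; exists (logn p d, d`_(negn p))%N; split.
- rewrite [_.1]/= mem_iota add0n ltnS; apply: leq_trans (dvdn_leq_log p n0 dn) _.
  rewrite lognM ?expn_gt0 ?p0// pfactorK//.
  suff -> : logn p m = 0%N by rewrite addn0.
  by apply/eqP; rewrite -leqn0 leqNgt -pfactor_dvdn // expn1.
- rewrite [_.2]/= -dvdn_divisors//; have := partn_dvd (negn p) n0 dn.
  rewrite partnM ?expn_gt0 ?p0// (@part_p'nat (negn p) (p ^ a)%N) ?mul1n; last first.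
    by rewrite pnatNK pnatX pnat_id.
  by have -> : (m`_(negn p))%N = m by rewrite part_pnat_id// p'natE.
- by rewrite /= -p_part partnC.
Qed.

(** Bernoulli's inequality, multiplied by a constant large enough to absorb the slope [x - 1]. *)
Lemma succn_le_expr (R : realFieldType) (x : R) (a : nat) : 1 < x ->
  a.+1%:R <= (1 + (x - 1)^-1) * x ^+ a.
Proof.
move=> x1; set b := x - 1; have b0 : 0 < b by rewrite subr_gt0.
have bern : 1 + a%:R * b <= x ^+ a.
  elim: a => [|a IH]; first by rewrite mul0r addr0 expr0.
  rewrite exprS -natr1 (le_trans _ (ler_wpM2l _ IH))//; last by rewrite (le_trans _ (ltW x1)).
  have -> : x = 1 + b by rewrite /b addrC subrK.
  have := mulr_ge0 (ler0n R a) (sqr_ge0 b); nra.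
apply: le_trans (ler_wpM2l _ bern); last by rewrite addr_ge0// invr_ge0 ltW.
have ib : 0 < b^-1 by rewrite invr_gt0.
have -> : (1 + b^-1) * (1 + a%:R * b) = 1 + a%:R * b + b^-1 + a%:R.
  by field; rewrite gt_eqF.
rewrite -natr1; have := mulr_ge0 (ler0n R a) (ltW b0); lra.
Qed.

Lemma powR_gt1 (R : realType) (x e : R) : 1 < x -> 0 < e -> 1 < x `^ e.
Proof.
move=> x1 e0; have := @gt0_ltr_powR R e e0 1 x; rewrite !nnegrE powR1; apply=> //.
exact: le_trans (ltW x1).
Qed.

Lemma trunc_log_le_powR (R : realType) (e : R) : 0 < e ->
  exists2 C : R, 0 < C &
    forall n, (0 < n)%N -> (trunc_log 2 n).+1%:R <= C * n%:R `^ e.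
Proof.
move=> e0; have t1 : 1 < 2 `^ e :> R by apply: powR_gt1 => //; rewrite ltr1n.
exists (1 + (2 `^ e - 1)^-1); first by rewrite addr_gt0// invr_gt0 subr_gt0.
move=> n n0; apply: le_trans (succn_le_expr _ t1) _.
rewrite ler_pM2l; last by rewrite addr_gt0// invr_gt0 subr_gt0.
rewrite -powR_mulrn ?powR_ge0// powRAC ge0_ler_powR ?nnegrE ?powR_ge0 ?(ltW e0)//.
by rewrite powR_mulrn// -natrX ler_nat trunc_logP.
Qed.

(** Compare prime by prime. For [p ^ e >= 2] the factor [a + 1 <= 2 ^ a <= p ^ (e a)] costs nothing;
    each smaller prime costs at most [B], and there are at most [P] of them, whence the constant
    [B ^ P]. *)
Lemma size_divisors_le_powR (R : realType) (e : R) : 0 < e ->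
  exists2 C : R, 0 < C &
    forall n, (0 < n)%N -> (size (divisors n))%:R <= C * n%:R `^ e.
Proof.
move=> e0; have t1 : 1 < 2 `^ e :> R by apply: powR_gt1 => //; rewrite ltr1n.
pose B := 1 + (2 `^ e - 1)^-1.
have B1 : 1 <= B by rewrite lerDl invr_ge0 subr_ge0 ltW.
have B0 : 0 < B := lt_le_trans ltr01 B1.
pose P := (Num.truncn (2 `^ e^-1 : R)).+1.
pose small := fun p : nat => (p < P)%N.
have main n : (0 < n)%N ->
    (size (divisors n))%:R <= B ^+ count small (primes n) * n%:R `^ e.
  elim/ltn_ind: n => n IH n0; case: (leqP n 1) => n1.
    have -> : n = 1%N by apply/eqP; rewrite eqn_leq n1.
    by rewrite powR1 mul1r.
  pose p := pdiv n; have pp : prime p := pdiv_prime n1.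
  have pn : (p %| n)%N := pdiv_dvd n.
  have [m cpm nE] := pfactor_coprime pp n0; set a := logn p n in nE.
  have a0 : (0 < a)%N by rewrite /a logn_gt0 mem_primes pp n0.
  have m0 : (0 < m)%N by move: n0; rewrite nE; case: (m).
  have pm : ~~ (p %| m)%N by rewrite -prime_coprime.
  have mn : (m < n)%N.
    rewrite nE -{1}(muln1 m) ltn_pmul2l// -{1}(expn0 p) ltn_exp2l ?prime_gt1//.
  have Pr : perm_eq (primes n) (p :: primes m).
    apply: uniq_perm; rewrite /= ?primes_uniq ?andbT//.
      by rewrite mem_primes pp m0.
    move=> r; rewrite nE primesM ?expn_gt0 ?(prime_gt0 pp)//.
    by rewrite primesX// (primes_prime pp) !in_cons in_nil orbF orbC.
  rewrite (permP Pr) /= exprD.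
  have aP : a.+1%:R <= B ^+ small p * (p%:R `^ e) ^+ a.
    rewrite /small; case: ltnP => pP /=.
      rewrite expr1; apply: le_trans (succn_le_expr _ t1) _.
      rewrite ler_pM2l// lerXn2r ?nnegrE ?powR_ge0//.
      by rewrite ge0_ler_powR ?nnegrE ?ler0n ?(ltW e0)// ler_nat prime_gt1.
    rewrite mul1r; apply: (@le_trans _ _ (2 ^+ a)).
      by rewrite -natrX ler_nat ltn_expl.
    rewrite lerXn2r ?nnegrE ?powR_ge0//.
    have -> : 2 = (2 `^ e^-1) `^ e :> R.
      by rewrite -powRrM mulVf ?gt_eqF// powRr1.
    rewrite ge0_ler_powR ?nnegrE ?powR_ge0 ?ler0n ?(ltW e0)//.
    by rewrite ltW// (lt_le_trans (truncnS_gt _))// ler_nat.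
  have nR : n%:R `^ e = (p%:R `^ e) ^+ a * m%:R `^ e :> R.
    rewrite {1}nE natrM powRM// mulrC natrX -(powR_mulrn a)// -powRrM mulrC.
    by rewrite powRrM powRAC powR_mulrn ?powR_ge0// mulrC.
  apply: (@le_trans _ _ (a.+1%:R * (size (divisors m))%:R)).
    by rewrite -natrM ler_nat {1}nE mulnC size_divisors_pfactor.
  apply: le_trans (ler_pM (ler0n _ _) (ler0n _ _) aP (IH m mn m0)) _.
  by rewrite nR mulrACA.
exists (B ^+ P); first exact: exprn_gt0.
move=> n n0; apply: le_trans (main n n0) _.
rewrite ler_wpM2r ?powR_ge0// ler_weXn2l// -size_filter.
rewrite -(size_iota 0 P); apply: uniq_leq_size.
  by rewrite filter_uniq// primes_uniq.
by move=> p; rewrite mem_filter mem_iota => /andP[].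
Qed.

(** * Partial sums of the zeta series *)

(** Each dyadic block contributes at most 1. *)
Lemma sum_inv_le (R : realFieldType) (t n : nat) : (n < 2 ^ t)%N ->
  \sum_(1 <= d < n.+1) (d%:R : R)^-1 <= t%:R.
Proof.
elim: t n => [|t IH] n nt; first by rewrite big_geq// ltnS -ltnS.
have t0 : (0 < 2 ^ t)%N by rewrite expn_gt0.
case: (ltnP n (2 ^ t)) => nt'.
  by apply: le_trans (IH n nt') _; rewrite ler_nat.
rewrite (@big_cat_nat _ _ _ (2 ^ t)%N)//=; last exact: leqW.
rewrite -natr1; apply: lerD.
  by rewrite -{1}(prednK t0); apply: IH; rewrite prednK.
apply: (@le_trans _ _ (\sum_(2 ^ t <= d < n.+1) ((2 ^ t)%:R : R)^-1)).
  rewrite !big_nat; apply: ler_sum => d /andP[td _].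
  by rewrite lef_pV2 ?posrE ?ltr0n ?(leq_trans t0)// ler_nat.
rewrite sumr_const_nat -[leLHS]mulr_natl ler_pdivrMr ?ltr0n// mul1r ler_nat.
by rewrite leq_subLR addnn -mul2n -expnS.
Qed.

Section ZetaPartialSums.
Variables (R : realType) (k : nat).
Hypothesis k2 : (2 <= k)%N.

Lemma series_riemannRE n :
  series (riemannR (k%:R : R)) n = \sum_(1 <= j < n.+1) (j%:R ^+ k)^-1.
Proof.
rewrite /series /= big_add1 /=; apply: eq_bigr => i _.
by rewrite /riemannR powR_mulrn.
Qed.

(** Telescoping: for [b = a + 1], [1 / b ^ k] is at most [1 / a ^ (k - 1) - 1 / b ^ (k - 1)],
    because [1 / a - 1 / b = 1 / (a b)]. *)
Lemma sum_invXn_le m n : (0 < m <= n)%N ->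
  \sum_(m.+1 <= j < n.+1) (j%:R ^+ k : R)^-1 <=
    (m%:R ^+ k.-1)^-1 - (n%:R ^+ k.-1)^-1.
Proof.
case: k k2 => [|[|j]] // _ /andP[m0]; rewrite [_.-1]/=.
elim: n => [|n IH]; first by rewrite leqn0 => /eqP mE; rewrite mE in m0.
rewrite leq_eqVlt => /orP[/eqP ->|]; first by rewrite big_geq// subrr.
rewrite ltnS => mn; rewrite big_nat_recr//=.
apply: le_trans (lerD (IH mn) (lexx _)) _.
have n0 : (0 < n)%N := leq_trans m0 mn.
have a0 : 0 < n%:R :> R by rewrite ltr0n.
have b0 : 0 < n.+1%:R :> R by rewrite ltr0n.
have bE : n.+1%:R = n%:R + 1 :> R by rewrite natr1.
set a := n%:R in a0 bE *; set b := n.+1%:R in b0 bE *.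
rewrite -addrA lerD2l addrC -lerBrDr opprK.
have ab : a^-1 * (b ^+ j)^-1 <= (a ^+ j.+1)^-1.
  rewrite exprS invfM ler_pM2l ?invr_gt0// lef_pV2 ?posrE ?exprn_gt0//.
  by rewrite lerXn2r ?nnegrE ?(ltW a0) ?(ltW b0)// bE lerDl.
rewrite [leRHS]addrC; apply: (@le_trans _ _ (a^-1 * (b ^+ j)^-1 - (b ^+ j.+1)^-1)); last first.
  by rewrite lerD2r.
rewrite !exprS !invfM.
have -> : a^-1 * (b ^+ j)^-1 - b^-1 * (b ^+ j)^-1 = a^-1 * (b^-1 * (b ^+ j)^-1).
  by rewrite bE; field; rewrite -bE expf_neq0 ?gt_eqF//.
by rewrite ler_pM2r ?mulr_gt0 ?invr_gt0 ?exprn_gt0// lef_pV2 ?posrE// bE lerDl.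
Qed.

Lemma zeta_sub_partial_sum n : (0 < n)%N ->
  0 <= zeta (k%:R : R) - \sum_(1 <= j < n.+1) (j%:R ^+ k)^-1 <= (n%:R ^+ k.-1)^-1.
Proof.
move=> n0; have pos j : 0 <= (j%:R ^+ k : R)^-1 by rewrite invr_ge0 exprn_ge0.
have mono : nondecreasing_seq (series (riemannR (k%:R : R))).
  by apply/nondecreasing_series => i _ _; rewrite /riemannR invr_ge0 powR_ge0.
have ubS m m' : (0 < m <= m')%N -> series (riemannR (k%:R : R)) m' <=
    series (riemannR (k%:R : R)) m + (m%:R ^+ k.-1)^-1.
  move=> mm'; case/andP: (mm') => m0 mm2.
  rewrite !series_riemannRE (@big_cat_nat _ _ _ m.+1)//= lerD2l.
  by apply: le_trans (sum_invXn_le mm') _; rewrite gerBl invr_ge0 exprn_ge0.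
have ub : cvgn (series (riemannR (k%:R : R))).
  apply: nondecreasing_is_cvgn => //.
  exists (series (riemannR (k%:R : R)) n + (n%:R ^+ k.-1)^-1) => _ [m _ <-].
  case: (leqP n m) => nm; first by apply: ubS; rewrite n0.
  apply: (le_trans (mono _ _ (ltnW nm))).
  by rewrite lerDl invr_ge0 exprn_ge0.
rewrite -series_riemannRE /zeta subr_ge0 lerBlDl; apply/andP; split.
  exact: nondecreasing_cvgn_le.
apply: limr_le => //; near=> m; apply: ubS; rewrite n0 /=.
by near: m; exact: nbhs_infty_ge.
Unshelve. all: by end_near.
Qed.

Lemma zeta_ge1 : 1 <= zeta (k%:R : R).
Proof.
have /andP[+ _] := zeta_sub_partial_sum (ltn0Sn 0).
by rewrite big_nat1 expr1n invr1 subr_ge0.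
Qed.

(** The inverse of zeta is reached through finite sums only: weighting each [d] by the partial zeta
    sum up to [z / d] gives exactly 1, and replacing these partial sums by zeta costs their
    tails. *)
Lemma sum_mu_div_zeta z : (0 < z)%N ->
  `|\sum_(1 <= d < z.+1) (mu d)%:~R / d%:R ^+ k - (zeta (k%:R : R))^-1|
    <= 2 ^+ k.-1 * (trunc_log 2 z).+1%:R / z%:R ^+ k.-1.
Proof.
move=> z0; set Z := zeta _; have Z1 : 1 <= Z := zeta_ge1.
have Z0 : 0 < Z := lt_le_trans ltr01 Z1.
have zR : 0 < z%:R :> R by rewrite ltr0n.
set P := \sum_(_ <= _ < _) _.
(* The pairs [(d, e)] are grouped by their product [l = d e <= z], where [sum_mu_dvd] leaves only
   [l = 1]. *)
have one : \sum_(1 <= d < z.+1) (mu d)%:~R / d%:R ^+ k *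
     \sum_(1 <= e < (z %/ d).+1) (e%:R ^+ k)^-1 = 1 :> R.
  transitivity (\sum_(1 <= d < z.+1) \sum_(1 <= l < z.+1 | (d %| l)%N)
                  (mu d)%:~R / l%:R ^+ k : R).
    apply: eq_big_nat => d /andP[d0 _].
    rewrite (sum_multiples _ (fun l => (mu d)%:~R / l%:R ^+ k) d0) mulr_sumr.
    by apply: eq_bigr => e _; rewrite natrM exprMn invfM mulrA.
  under eq_bigr do rewrite big_mkcond.
  rewrite exchange_big /=.
  transitivity (\sum_(1 <= l < z.+1) ((l == 1%N)%:R / l%:R ^+ k : R)).
    apply: eq_big_nat => l lz; rewrite -big_mkcond /=.
    have := congr1 (fun x : int => x%:~R / l%:R ^+ k : R) (sum_mu_dvd lz).
    by rewrite /= rmorph_sum /= mulr_suml => ->; case: (l == _).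
  rewrite big_ltn ?ltnS// eqxx expr1n divr1 big_nat_cond big1 ?addr0//.
  by move=> l /andP[/andP[l1 _] _]; case: eqP l1 => [->//|]; rewrite mul0r.
have main : `|P * Z - 1| <= 2 ^+ k.-1 * (trunc_log 2 z).+1%:R / z%:R ^+ k.-1.
  have -> : P * Z - 1 = \sum_(1 <= d < z.+1) (mu d)%:~R / d%:R ^+ k *
      (Z - \sum_(1 <= e < (z %/ d).+1) (e%:R ^+ k)^-1).
    by under eq_bigr do rewrite mulrBr; rewrite sumrB one -mulr_suml.
  apply: (le_trans (ler_norm_sum _ _ _)).
  apply: (@le_trans _ _ (\sum_(1 <= d < z.+1) (2 ^+ k.-1 / z%:R ^+ k.-1) * (d%:R : R)^-1)).
    rewrite !big_nat; apply: ler_sum => d /andP[d0 dz].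
    have d0R : 0 < d%:R :> R by rewrite ltr0n.
    have q0 : (0 < z %/ d)%N by rewrite divn_gt0.
    have q0R : 0 < (z %/ d)%:R :> R by rewrite ltr0n.
    have /andP[t0 t1] := zeta_sub_partial_sum q0.
    rewrite !normrM normfV (ger0_norm t0) (ger0_norm (exprn_ge0 _ (ltW d0R))).
    apply: (@le_trans _ _ (1 / d%:R ^+ k * ((z %/ d)%:R ^+ k.-1)^-1)).
      apply: ler_pM => //.
      rewrite ler_pM2r ?invr_gt0 ?exprn_gt0// -intr_norm.
      by rewrite (ler_int R _ 1) norm_mu_le1.
    rewrite mul1r -{1}(prednK (ltnW k2)) exprS ler_pdivlMr// ler_pdivlMr ?exprn_gt0//.
    have -> : (d%:R * d%:R ^+ k.-1)^-1 / (z %/ d)%:R ^+ k.-1 * d%:R * z%:R ^+ k.-1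
        = z%:R ^+ k.-1 / ((z %/ d)%:R * d%:R) ^+ k.-1 :> R.
      by rewrite exprMn; field; rewrite !expf_neq0 ?gt_eqF.
    rewrite ler_pdivrMr ?exprn_gt0 ?mulr_gt0// -exprMn.
    rewrite lerXn2r ?nnegrE ?mulr_ge0//.
    (* The quotient [z %/ d] is positive, so [z <= 2 * d * (z %/ d)]; this is the source of the
       factor [2 ^ (k - 1)]. *)
    rewrite -!natrM ler_nat; have := ltn_ceil z d0.
    by move: q0; case: (z %/ d)%N => // q _; nia.
  rewrite -mulr_sumr mulrAC -!mulrA ler_pM2l ?exprn_gt0// ler_wpM2r ?invr_ge0 ?exprn_ge0//.
  by apply: sum_inv_le; rewrite trunc_log_ltn.
have -> : P - Z^-1 = (P * Z - 1) / Z by rewrite mulrBl mul1r mulfK// gt_eqF.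
rewrite normrM normfV (gtr0_norm Z0) ler_pdivrMr//.
by apply: (le_trans main); rewrite ler_peMr// (le_trans _ main).
Qed.

End ZetaPartialSums.

(** * Floor sums and Dirichlet approximation *)

Lemma floor_div_nat (R : realType) (x : R) (q : nat) : (0 < q)%N ->
  Num.floor (x / q%:R) = (Num.floor x %/ q%:Z)%Z.
Proof.
move=> q0; have q0R : 0 < q%:R :> R by rewrite ltr0n.
have q0Z : 0 < q%:Z by rewrite ltz_nat.
apply: floor_def; rewrite ler_pdivlMr// ltr_pdivrMr//; apply/andP; split.
  rewrite -[q%:R]/(q%:Z%:~R) -intrM; apply: le_trans (floor_le x).
  by rewrite ler_int lez_floor// gt_eqF.
by rewrite -[q%:R]/(q%:Z%:~R) -intrM -floor_lt_int ltz_ceil.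
Qed.

(* The left side minus [n] has periods [q] and [a], hence period 1. *)
Lemma sum_divz_coprime (a : int) (q : nat) (n : int) :
  (0 < q)%N -> coprimez a q%:Z ->
  \sum_(0 <= m < q) ((m%:Z * a + n) %/ q%:Z)%Z =
  n + \sum_(0 <= m < q) ((m%:Z * a) %/ q%:Z)%Z.
Proof.
move=> q0 /coprimezP[[u v] /= uv]; have q0Z : q%:Z != 0 by rewrite eqz_nat -lt0n.
pose F (x : int) : int := \sum_(0 <= m < q) ((m%:Z * a + x) %/ q%:Z)%Z.
pose G (x : int) : int := F x - x.
have pa (x : int) : G (x + a) = G x.
  (* One sum over [q + 1] indices is expanded in two ways, splitting off [m = 0] or [m = q];
     comparing them gives [F (x + a) = F x + a]. *)
  have : \sum_(0 <= m < q.+1) ((m%:Z * a + x) %/ q%:Z)%Z =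
         \sum_(0 <= m < q.+1) ((m%:Z * a + x) %/ q%:Z)%Z by [].
  rewrite {1}big_nat_recl// big_nat_recr//= mul0r add0r.
  rewrite [q%:Z * a]mulrC divzMDl//.
  under eq_bigr do rewrite intS mulrDl mul1r (addrC a) -addrA (addrC a).
  rewrite -/(F x) -/(F (x + a)) /G => H; lia.
have pq (x : int) : G (x + q%:Z) = G x.
  have -> : G (x + q%:Z) = \sum_(0 <= m < q) (1 + ((m%:Z * a + x) %/ q%:Z)%Z) - (x + q%:Z).
    rewrite /G /F; congr (_ - _); apply: eq_bigr => m _.
    by rewrite -divzMDl//; congr (_ %/ _)%Z; ring.
  rewrite big_split /= sumr_const_nat subn0 -/(F x) /G.
  rewrite (_ : 1 *+ q = q%:Z); first by ring.
  by rewrite pmulrn intz.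
have per b (pb : forall x, G (x + b) = G x) i x : G (x + i * b) = G x.
  elim: i => [|i IH|i IH]; first by rewrite mul0r addr0.
    by rewrite intS mulrDl mul1r (addrC b) addrA pb.
  rewrite -[LHS]pb -IH; congr G; lia.
have p1 x : G (x + 1) = G x by rewrite -uv addrA !per.
have : G n = G 0.
  by rewrite -[n in LHS]add0r -[n in LHS]mulr1; exact: per.
rewrite /G subr0 => /eqP; rewrite subr_eq addrC -/(F n) => /eqP ->.
by congr (_ + _); apply: eq_bigr => m _; rewrite addr0.
Qed.

Section FloorSums.
Variables (R : realType) (g : R).

(** In a difference of two floor sums of the same slope, the contribution of the slope cancels and
    the mean [M (c - c')] remains. Cutting the range shifts [c] and [c'], so all bounds below are
    uniform in them. *)
Definition floor_gap (c c' : R) (M : nat) : R :=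
  \sum_(0 <= m < M) (Num.floor (m%:R * g + c) - Num.floor (m%:R * g + c'))%:~R
  - M%:R * (c - c').

Lemma floor_gapD c c' M M' : floor_gap c c' (M + M') =
  floor_gap c c' M + floor_gap (M%:R * g + c) (M%:R * g + c') M'.
Proof.
rewrite /floor_gap (@big_cat_nat _ _ _ M)//= ?leq_addr//.
rewrite -{2}(add0n M) big_addn addKn natrD.
have -> : \sum_(0 <= i < M') (Num.floor ((i + M)%:R * g + c) -
      Num.floor ((i + M)%:R * g + c'))%:~R =
   \sum_(0 <= i < M') (Num.floor (i%:R * g + (M%:R * g + c)) -
      Num.floor (i%:R * g + (M%:R * g + c')))%:~R :> R.
  by apply: eq_bigr => i _; rewrite natrD mulrDl !addrA.
ring.
Qed.

(** For [m < q], replacing [g] by [a / q] moves each argument by at most [1 / q]. The sum thus lies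
    between the exact sums for [c - 1 / q] and [c + 1 / q], which depend on [c] only through the
    floors of [q c - 1] and [q c + 1]. *)
Lemma sum_floor_block (a : int) (q : nat) (c : R) : (0 < q)%N ->
  coprimez a q%:Z -> `|q%:R * g - a%:~R| <= q%:R^-1 ->
  exists2 e : R, `|e| <= 2 &
    \sum_(0 <= m < q) (Num.floor (m%:R * g + c))%:~R =
    q%:R * c + (\sum_(0 <= m < q) ((m%:Z * a) %/ q%:Z)%Z)%:~R + e.
Proof.
move=> q0 cop ga; have q0R : 0 < q%:R :> R by rewrite ltr0n.
set K := \sum_(_ <= _ < _) (_ %/ _)%Z.
have exact_sum (y : R) :
    \sum_(0 <= m < q) Num.floor (m%:R * a%:~R / q%:R + y) = Num.floor (q%:R * y) + K.
  rewrite -sum_divz_coprime//; apply: eq_bigr => m _.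
  have -> : m%:R * a%:~R / q%:R + y = (q%:R * y + (m%:Z * a)%:~R) / q%:R :> R.
    by rewrite intrM; field; rewrite gt_eqF.
  by rewrite floor_div_nat// floorDrz ?intr_int// intrKfloor addrC.
have near m : (m < q)%N -> `|m%:R * g - m%:R * a%:~R / q%:R| <= q%:R^-1.
  move=> mq; have -> : m%:R * g - m%:R * a%:~R / q%:R = m%:R / q%:R * (q%:R * g - a%:~R) :> R.
    by field; rewrite gt_eqF.
  rewrite normrM ger0_norm ?divr_ge0// (le_trans _ ga)// ler_piMl//.
  by rewrite ler_pdivrMr// mul1r ler_nat ltnW.
have lo : (Num.floor (q%:R * c - 1))%:~R + K%:~R <=
    \sum_(0 <= m < q) (Num.floor (m%:R * g + c))%:~R :> R.
  have -> : q%:R * c - 1 = q%:R * (c - q%:R^-1) by field; rewrite gt_eqF.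
  rewrite -intrD -exact_sum -rmorph_sum ler_int !big_nat; apply: ler_sum => m /andP[_ mq].
  by apply: le_floor; have := near m mq; rewrite ler_norml => /andP[]; lra.
have hi : \sum_(0 <= m < q) (Num.floor (m%:R * g + c))%:~R <=
    (Num.floor (q%:R * c + 1))%:~R + K%:~R :> R.
  have -> : q%:R * c + 1 = q%:R * (c + q%:R^-1) by field; rewrite gt_eqF.
  rewrite -intrD -exact_sum -rmorph_sum ler_int !big_nat; apply: ler_sum => m /andP[_ mq].
  by apply: le_floor; have := near m mq; rewrite ler_norml => /andP[]; lra.
exists (\sum_(0 <= m < q) (Num.floor (m%:R * g + c))%:~R - q%:R * c - K%:~R); last by ring.
have := floor_le (q%:R * c + 1); have := floorD1_gt (q%:R * c - 1); rewrite intrD.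
by rewrite ler_norml; move: lo hi; set S := \sum_(_ <= _ < _) _; lra.
Qed.

Lemma floor_gap_blocks (a : int) (q t : nat) (c c' : R) : (0 < q)%N ->
  coprimez a q%:Z -> `|q%:R * g - a%:~R| <= q%:R^-1 ->
  `|floor_gap c c' (t * q)| <= 4 * t%:R.
Proof.
move=> q0 cop ga; elim: t c c' => [|t IH] c c'.
  by rewrite mul0n /floor_gap big_geq// mul0r subr0 normr0 mulr0.
rewrite mulSn floor_gapD (_ : 4 * t.+1%:R = 4 + 4 * t%:R :> R); last first.
  by rewrite -natr1; ring.
apply: le_trans (ler_normD _ _) _; rewrite lerD//.
have [e e2 eE] := sum_floor_block c q0 cop ga.
have [e' e2' eE'] := sum_floor_block c' q0 cop ga.
rewrite /floor_gap; under eq_bigr do rewrite intrB.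
rewrite sumrB eE eE'; move: e2 e2'; rewrite !ler_norml => /andP[? ?] /andP[? ?].
apply/andP; split; nra.
Qed.

(** Pigeonhole on [M + 1] fractional parts in [M] boxes. The fraction is then reduced, since the
    exact block sums require [a] and [q] coprime. *)
Lemma dirichlet_approx M : (0 < M)%N -> exists (q : nat) (a : int),
  [/\ (0 < q <= M)%N, coprimez a q%:Z & `|q%:R * g - a%:~R| <= M%:R^-1].
Proof.
move=> M0; have M0R : 0 < M%:R :> R by rewrite ltr0n.
pose fr (i : nat) := i%:R * g - (Num.floor (i%:R * g))%:~R.
have fr0 i : 0 <= fr i by rewrite subr_ge0 floor_le.
have fr1 i : fr i < 1.
  by have := floorD1_gt (i%:R * g); rewrite intrD /fr; lra.
have bin i : (Num.truncn (M%:R * fr i) < M)%N.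
  rewrite truncn_lt_nat ?mulr_ge0 ?(ltW M0R)//.
  by rewrite -[ltRHS]mulr1 ltr_pM2l.
pose f (i : 'I_M.+1) : 'I_M := Ordinal (bin i).
have /injectivePn[x [y xy fxy]] : ~~ injectiveb f.
  by apply/negP => /injectiveP /leq_card; rewrite !card_ord ltnn.
wlog lt_xy : x y xy fxy / (x < y)%N.
  move=> H; case: (ltngtP x y) => [lxy|lyx|e]; first exact: (H x y).
    by apply: (H y x) => //; rewrite eq_sym.
  by move: xy; rewrite -val_eqE /= e eqxx.
have close : `|fr y - fr x| <= M%:R^-1.
  have := congr1 val fxy; rewrite /f /= => tE.
  have /andP[x1 x2] := truncn_itv (mulr_ge0 (ltW M0R) (fr0 x)).
  have /andP[y1 y2] := truncn_itv (mulr_ge0 (ltW M0R) (fr0 y)).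
  have : `|M%:R * (fr y - fr x)| <= 1.
    by move: x1 x2 y1 y2; rewrite tE -natr1 ler_norml; lra.
  by rewrite normrM gtr0_norm// mulrC -ler_pdivlMr// div1r.
pose Q := (y - x)%N; pose A := Num.floor (y%:R * g) - Num.floor (x%:R * g).
have Q0 : (0 < Q)%N by rewrite subn_gt0.
have QM : (Q <= M)%N by apply: leq_trans (leq_subr _ _) _; rewrite -ltnS.
have QA : `|Q%:R * g - A%:~R| <= M%:R^-1.
  move: close; rewrite /fr /Q /A natrB ?intrB 1?ltnW//.
  by congr (`|_| <= _); ring.
(* Dividing by the gcd divides the approximation error by it as well. *)
pose d := gcdz A Q; have d0 : (0 < `|d|)%N.
  by rewrite absz_gt0 gcdz_eq0 negb_and eqz_nat -!lt0n Q0 orbT.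
have dQ : (`|d| %| Q)%N by have := dvdz_gcdr A Q; rewrite dvdzE.
have dE : d = `|d|%:Z by [].
exists (Q %/ `|d|)%N, (A %/ d)%Z; split.
- by rewrite divn_gt0// dvdn_leq//= (leq_trans (leq_div _ _)).
- have : gcdz (A %/ d)%Z (Q %/ `|d|)%N%:Z * `|d|%:Z = d.
    rewrite mulz_gcdl divzK ?dvdz_gcdl//.
    by have -> : (Q %/ `|d|)%N%:Z * d = Q%:Z by rewrite {2}dE -PoszM divnK.
  rewrite -dE => H; have dn0 : d != 0 by rewrite -absz_gt0.
  by rewrite /coprimez; apply/eqP; apply: (mulIf dn0); rewrite mul1r H.
- have d1 : 1 <= `|d|%:R :> R by rewrite ler1n.
  have : `|d|%:R * `|(Q %/ `|d|)%:R * g - (A %/ d)%Z%:~R| <= M%:R^-1.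
    rewrite -{1}(ger0_norm (ler0n R `|d|)) -normrM mulrBr mulrA -natrM mulnC divnK//.
    by rewrite -[`|d|%:R]/(`|d|%:Z%:~R) -dE -intrM [d * _]mulrC divzK ?dvdz_gcdl.
  by apply: le_trans; rewrite ler_peMl.
Qed.

(* Split off the blocks of length [q], with [q] from Dirichlet's theorem for
   [M]; the remainder [M %% q] is less than half of [M]. *)
Lemma floor_gap_le (V M : nat) :
  (forall (M' q : nat) (a : int), (0 < q <= M')%N -> (M' <= M)%N ->
     `|q%:R * g - a%:~R| <= M'%:R^-1 -> (M' <= V * q)%N) ->
  forall c c', `|floor_gap c c' M| <= 4 * V%:R * (trunc_log 2 M).+1%:R.
Proof.
elim/ltn_ind: M => M IH H c c'; case: (posnP M) => [->|M0].
  rewrite /floor_gap big_geq// mul0r subr0 normr0.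
  by rewrite !mulr_ge0.
have [q [a [/andP[q0 qM] cop ga]]] := dirichlet_approx M0.
(* The hypothesis at [M' = M] bounds the number of full blocks, each of which costs at most 4. *)
have tV : (M %/ q <= V)%N.
  rewrite -ltnS ltn_divLR//; apply: leq_ltn_trans (H M q a _ (leqnn M) ga) _.
    by rewrite q0.
  by rewrite ltn_pmul2r.
have modlt : (M %% q < q)%N := ltn_pmod M q0.
have modM : (M %% q < M)%N := leq_trans modlt qM.
rewrite (divn_eq M q) floor_gapD; apply: le_trans (ler_normD _ _) _.
rewrite -divn_eq.
have b1 : `|floor_gap c c' (M %/ q * q)| <= 4 * V%:R.
  apply: (@le_trans _ _ (4 * (M %/ q)%:R)); last by rewrite ler_pM2l// ler_nat.
  apply: floor_gap_blocks (cop) _ => //; apply: le_trans ga _.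
  by rewrite lef_pV2 ?posrE ?ltr0n// ler_nat.
have IH' := IH _ modM (fun M' q' a' h1 h2 => H M' q' a' h1 (leq_trans h2 (ltnW modM))).
case: (posnP (M %% q)) => [r0|r0].
  rewrite r0 [in X in _ + X]/floor_gap big_geq// mul0r subr0 normr0 addr0.
  by apply: le_trans b1 _; rewrite ler_peMr ?mulr_ge0// ler1n.
apply: le_trans (lerD b1 (IH' _ _)) _.
rewrite -[X in X + _]mulr1 -mulrDr ler_wpM2l ?mulr_ge0// nat1r ler_nat ltnS.
rewrite -trunc_log2_double// leq_trunc_log// -addnn.
rewrite {3}(divn_eq M q) leq_add2r; apply: leq_trans (ltnW modlt) _.
by rewrite leq_pmull// divn_gt0.
Qed.

End FloorSums.

(** * Counting multiples close to integers *)

Lemma size_le_progression (s : seq nat) (q S : nat) : (0 < q)%N -> uniq s ->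
  (forall x y, x \in s -> y \in s -> (x <= y)%N ->
     exists2 j, y = (x + j * q)%N & (j <= S)%N) ->
  (size s <= S.+1)%N.
Proof.
move=> q0 us H; case: s us H => [//|x0 s] us H.
have ex : exists x, x \in x0 :: s by exists x0; rewrite mem_head.
have [m ms mmin] := ex_minnP ex.
have repr x : x \in x0 :: s -> exists2 j, x = (m + j * q)%N & (j <= S)%N.
  by move=> xs; apply: H => //; exact: mmin.
rewrite -(size_map (fun x => (x - m) %/ q)%N) -(size_iota 0 S.+1).
apply: uniq_leq_size.
  rewrite map_inj_in_uniq// => x y /repr[j -> _] /repr[j' -> _].
  by rewrite !addKn !mulnK// => ->.
move=> _ /mapP[x /repr[j -> jS] ->]; rewrite addKn mulnK//.
by rewrite mem_iota add0n ltnS.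
Qed.

Lemma size_le_classes (T : Type) (f : T -> nat) (N B : nat) (s : seq T) :
  all (fun x => f x < N)%N s ->
  (forall i, (count (fun x => f x == i) s <= B)%N) -> (size s <= N * B)%N.
Proof.
elim: N s => [|N IH] s; first by case: s.
move=> sN H; rewrite -(count_predC (fun x => f x == N)) mulSn leq_add//.
rewrite -size_filter; apply: IH => [|i].
  rewrite all_filter; apply: sub_all sN => x /=.
  by rewrite ltnS leq_eqVlt => /orP[->//|->]; rewrite implybT.
by rewrite count_filter (leq_trans _ (H i))//; apply: sub_count => x /= /andP[].
Qed.

Lemma count_iota_blocks (P : pred nat) (K B : nat) : (0 < K)%N ->
  (forall n, (count P (iota n K) <= B)%N) ->
  forall L n, (count P (iota n L) <= (L %/ K).+1 * B)%N.
Proof.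
move=> K0 H; elim/ltn_ind => L IH n; case: (ltnP L K) => LK.
  rewrite divn_small// mul1n; apply: leq_trans (H n).
  have -> : iota n K = iota n L ++ iota (n + L) (K - L).
    by rewrite -iotaD subnKC// ltnW.
  by rewrite count_cat leq_addr.
rewrite -{1}(subnKC LK) iotaD count_cat -{2}(subnKC LK) divnDl// divnn K0.
rewrite add1n mulSn leq_add//; apply: IH.
by rewrite ltn_subrL K0 (leq_trans K0).
Qed.

Section NearIntegers.
Variable R : realType.

Definition near_int (x : R) : int := Num.floor (x + 2^-1).

(** The distance to an explicit nearest integer, in place of an infimum; [dist_intE] identifies it
    with [dist_int]. *)
Definition dint (x : R) : R := `|x - (near_int x)%:~R|.

Lemma dint_le x (a : int) : dint x <= `|x - a%:~R|.
Proof.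
have := floor_itv (x + 2^-1); rewrite /dint -/(near_int x) intrD => /andP[lo hi].
have half : `|x - (near_int x)%:~R| <= 2^-1.
  by rewrite ler_norml; move: lo hi; lra.
have [->//|ne] := eqVneq a (near_int x).
have : 1 <= `|(near_int x)%:~R - a%:~R| :> R.
  rewrite -intrB -intr_norm (ler_int R 1) -gtz0_ge1 normr_gt0 subr_eq0 eq_sym//.
have := ler_distD x (near_int x)%:~R a%:~R; rewrite (distrC _ x); lra.
Qed.

Variables (g : R) (a : int) (q : nat).
Hypotheses (q0 : (0 < q)%N) (cop : coprimez a q%:Z).
Hypothesis gap0 : 0 < `|q%:R * g - a%:~R|.

(* The integer [l a - h q], with [h] the nearest integer to [l g], takes at most
   five values when [l] runs over the points close to an integer in a block of
   length at most [1 / |q g - a|]; each value determines [l] modulo [q]. *)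
Let u (l : nat) : int := l%:Z * a - near_int (l%:R * g) * q%:Z.

Let uE l : (u l)%:~R = q%:R * (l%:R * g - (near_int (l%:R * g))%:~R)
  - l%:R * (q%:R * g - a%:~R) :> R.
Proof. by rewrite /u intrB !intrM /=; ring. Qed.

(** Equality of [u] makes [q] divide [(y - x) a], hence [y - x]. By [uE], it also makes
    [j (q g - a)] the difference of the two signed distances, each at most [d] in absolute value. *)
Lemma near_int_class x y (d : R) : (x <= y)%N -> u x = u y ->
  dint (x%:R * g) <= d -> dint (y%:R * g) <= d ->
  exists2 j, y = (x + j * q)%N & j%:R * `|q%:R * g - a%:~R| <= 2 * d.
Proof.
move=> xy uxy dx dy.
have q0Z : q%:Z != 0 by rewrite eqz_nat -lt0n.
have /dvdzP[j jE] : (q%:Z %| (y - x)%N%:Z)%Z.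
  rewrite -(@Gauss_dvdzl _ _ a) 1?coprimez_sym// ?coprimezE//.
  apply/dvdzP; exists (near_int (y%:R * g) - near_int (x%:R * g)).
  rewrite -subzn// !mulrBl; move: uxy; rewrite /u; lia.
have j0 : 0 <= j.
  have : 0 <= j * q%:Z by rewrite -jE.
  by rewrite pmulr_lge0// ltz_nat.
case: j j0 jE => // j _ jE.
have yE : y = (x + j * q)%N by move/eqP: jE; rewrite -PoszM eqz_nat; lia.
exists j => //.
have -> : j%:R * `|q%:R * g - a%:~R| = `|j%:R * (q%:R * g - a%:~R)|.
  by rewrite normrM ger0_norm.
have := congr1 (fun z : int => z%:~R : R) uxy; rewrite /= !uE yE => E.
rewrite -yE in E; pose X := x%:R * g - (near_int (x%:R * g))%:~R.
pose Y := y%:R * g - (near_int (y%:R * g))%:~R.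
have -> : j%:R * (q%:R * g - a%:~R) = Y - X.
  have qR : q%:R != 0 :> R by rewrite pnatr_eq0 -lt0n.
  apply: (mulfI qR); apply: subr0_eq; move/eqP: E; rewrite -subr_eq0 => /eqP E.
  by rewrite -E -/X -/Y yE natrD natrM; ring.
move: dx dy; rewrite /dint -/X -/Y.
have := ler_normB Y X; lra.
Qed.

(** Each class of [u] is an arithmetic progression of step [q], limited both by the block length and
    by the bound of [near_int_class]. *)
Lemma count_near_int_block (K n : nat) (d : R) : K%:R * `|q%:R * g - a%:~R| <= 1 ->
  q%:R * d <= 1 ->
  (count (fun l => (dint (l%:R * g) <= d)%R) (iota n K) <=
     5 * minn (K %/ q).+1 (Num.truncn (2 * d / `|q%:R * g - a%:~R|)%R).+1)%N.
Proof.
move=> Kgap qd; set e := q%:R * g - a%:~R in Kgap *; have e0 : 0 < `|e| := gap0.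
have q0R : 0 < q%:R :> R by rewrite ltr0n.
rewrite -size_filter; set s := seq.filter _ _.
have sP l : l \in s -> [/\ (n <= l)%N, (l < n + K)%N & dint (l%:R * g) <= d].
  by rewrite mem_filter mem_iota => /andP[-> /andP[-> ->]].
have us : uniq s by rewrite filter_uniq// iota_uniq.
(* By [uE], [u l] differs from [w] by at most [q d + K |e| <= 2], so it takes one of the five values
   from [u0] to [u0 + 4]. *)
pose w := - n%:R * e; pose u0 := Num.floor (w - 2).
have uw l : l \in s -> `|(u l)%:~R - w| <= 2.
  move=> /sP[nl lK dl]; rewrite uE -/e /w.
  have -> : q%:R * (l%:R * g - (near_int (l%:R * g))%:~R) - l%:R * e - - n%:R * e =
    q%:R * (l%:R * g - (near_int (l%:R * g))%:~R) - (l - n)%:R * e.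
    by rewrite natrB//; ring.
  apply: (le_trans (ler_normB _ _)); rewrite !normrM !normr_nat -/(dint _).
  apply: (@le_trans _ _ (1 + 1)); last lra; apply: lerD.
    by apply: le_trans qd; rewrite ler_pM2l.
  apply: le_trans Kgap; rewrite ler_wpM2r// ler_nat; lia.
have u0P l : l \in s -> u0 <= u l < u0 + 5.
  move=> /uw; rewrite ler_norml => /andP[lo hi]; have /andP[f1 f2] := floor_itv (w - 2).
  rewrite intrD -/u0 in f2; rewrite -/u0 in f1.
  apply/andP; split; first by rewrite -(ler_int R); lra.
  by rewrite -(ltr_int R) intrD; lra.
apply: (@size_le_classes _ (fun l => `|u l - u0|%N)).
  by apply/allP => l /u0P; lia.
move=> i; rewrite leq_min -size_filter; set t := seq.filter _ s.
have ut : uniq t by rewrite filter_uniq.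
have tP l : l \in t -> l \in s /\ u l = u0 + i%:Z.
  by rewrite mem_filter => /andP[/eqP <- ls]; split=> //; have := u0P l ls; lia.
have cl x y : x \in t -> y \in t -> (x <= y)%N ->
    exists2 j, y = (x + j * q)%N & j%:R * `|e| <= 2 * d.
  move=> /tP[/sP[_ _ dx] ux] /tP[/sP[_ _ dy] uy] xy.
  by apply: near_int_class => //; rewrite ux uy.
apply/andP; split; apply: (size_le_progression q0 ut) => x y xt yt xy.
  have [j yE _] := cl x y xt yt xy; exists j => //.
  have [/sP[nx _ _] _] := tP x xt; have [/sP[_ yK _] _] := tP y yt.
  rewrite leq_divRL//; lia.
have [j yE je] := cl x y xt yt xy; exists j => //.
rewrite truncn_ge_nat; first by rewrite ler_pdivlMr.
by rewrite divr_ge0// (le_trans _ je)// mulr_ge0.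
Qed.

End NearIntegers.

(* Dirichlet's theorem at scale [1 / d] gives [q]: blocks of length [q] are good
   when [q >= H], blocks of length [1 / |q g - a|] when [q < H]. *)
Lemma count_near_int (R : realType) (g c th : R) : 0 < c -> 0 <= th ->
  (forall l, (0 < l)%N -> c * l%:R `^ (- th) <= dint (l%:R * g)) ->
  forall (L : nat) (d H : R), 0 < d <= 1 -> 0 < H ->
  (count (fun l => dint (l%:R * g) <= d)%R (iota 1 L))%:R <=
    40 * (L%:R / H + L%:R * d + d * H `^ th / c + 1).
Proof.
move=> c0 th0 cg L d H /andP[d0 d1] H0.
pose Q := Num.truncn d^-1.
have id1 : 1 <= d^-1 by rewrite invf_ge1.
have Q0 : (0 < Q)%N by rewrite truncn_gt0.
have Q0R : 0 < Q%:R :> R by rewrite ltr0n.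
have /andP[Q1 Q2] := truncn_itv (ltW (lt_le_trans ltr01 id1)).
have [q [a [/andP[q0 qQ] cop ga]]] := dirichlet_approx g Q0.
have q0R : 0 < q%:R :> R by rewrite ltr0n.
pose e : R := `|q%:R * g - a%:~R|; rewrite -/e in ga.
have e_lo : c * q%:R `^ (- th) <= e by apply: le_trans (cg q q0) (dint_le _ _).
have e0 : 0 < e by apply: lt_le_trans e_lo; rewrite mulr_gt0// powR_gt0.
have qd : q%:R * d <= 1.
  rewrite -ler_pdivlMr// div1r; apply: le_trans Q1; by rewrite ler_nat.
have e2d : e <= 2 * d.
  apply: (le_trans ga); rewrite -[2 * d]invrK lef_pV2 ?posrE ?invr_gt0 ?mulr_gt0//.
  rewrite invfM ler_pdivrMl//; apply: ltW; apply: (lt_le_trans Q2).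
  have : 1 <= Q%:R :> R by rewrite ler1n.
  by rewrite -/Q -natr1; lra.
have L0 : 0 <= L%:R :> R by [].
have t1 : 0 <= d * H `^ th / c by rewrite divr_ge0 ?mulr_ge0 ?powR_ge0 ?(ltW d0) ?(ltW c0).
have t2 : 0 <= L%:R / H by rewrite divr_ge0// ltW.
have t3 : 0 <= L%:R * d by rewrite mulr_ge0// ltW.
have block K n := @count_near_int_block R g a q q0 cop e0 K n d.
(* For [q >= H], a block of length [q] holds at most 10 points and there are at most [L / H + 1]
   blocks. *)
case: (leP H q%:R) => Hq.
  have qe : q%:R * e <= 1.
    rewrite -ler_pdivlMr// div1r; apply: le_trans (_ : Q%:R <= _); first by rewrite ler_nat.
    by rewrite -[Q%:R]invrK lef_pV2 ?posrE ?invr_gt0.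
  have hb n : (count (fun l => (dint (l%:R * g) <= d)%R) (iota n q) <= 10)%N.
    apply: leq_trans (block q n qe qd) _.
    by rewrite divnn q0 (leq_trans (leq_mul (leqnn 5) (geq_minl _ _))).
  have := count_iota_blocks q0 hb L 1.
  rewrite -(ler_nat R) natrM -natr1 => h; apply: (le_trans h).
  have : (L %/ q)%:R <= L%:R / H :> R.
    apply: (@le_trans _ _ (L%:R / q%:R)).
      by rewrite ler_pdivlMr// -natrM ler_nat leq_divM.
    by rewrite ler_wpM2l// lef_pV2 ?posrE.
  lra.
pose K := Num.truncn e^-1.
have ie1 : 1 <= e^-1.
  rewrite invf_ge1//; apply: (le_trans ga); rewrite invf_le1// ler1n//.
have K0 : (0 < K)%N by rewrite truncn_gt0.
have K0R : 0 < K%:R :> R by rewrite ltr0n.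
have /andP[K1 K2] := truncn_itv (ltW (lt_le_trans ltr01 ie1)).
have Ke : K%:R * e <= 1 by rewrite -ler_pdivlMr// div1r.
have K2e : K%:R^-1 <= 2 * e.
  rewrite -[2 * e]invrK lef_pV2 ?posrE ?invr_gt0 ?mulr_gt0//.
  rewrite invfM ler_pdivrMl//; apply: ltW; apply: (lt_le_trans K2).
  have : 1 <= K%:R :> R by rewrite ler1n.
  by rewrite -/K -natr1; lra.
pose S := Num.truncn (2 * d / e).
have de0 : 0 <= 2 * d / e by rewrite divr_ge0 ?mulr_ge0// ltW.
have hb n : (count (fun l => (dint (l%:R * g) <= d)%R) (iota n K) <= 5 * S.+1)%N.
  by apply: leq_trans (block K n Ke qd) _; rewrite leq_mul2l geq_minr.
have := count_iota_blocks K0 hb L 1.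
rewrite -(ler_nat R) !natrM -natr1 => h; apply: (le_trans h).
have LK : (L %/ K)%:R <= 2 * e * L%:R :> R.
  apply: (@le_trans _ _ (L%:R / K%:R)).
    by rewrite ler_pdivlMr// -natrM ler_nat leq_divM.
  by rewrite mulrC ler_wpM2r.
(* Since [e <= 2 d], the ratio [2 d / e] is at least 1 and absorbs the rounding. *)
have SS : S.+1%:R <= 4 * (d / e).
  rewrite -natr1; have /andP[S1 _] := truncn_itv de0.
  have : 1 <= 2 * d / e by rewrite ler_pdivlMr// mul1r.
  rewrite -/S in S1; lra.
(* The Diophantine lower bound at [q < H] keeps [e] away from 0. *)
have dH : d / e <= d * H `^ th / c.
  rewrite -mulrA ler_pM2l// -[_ / c]invrK invf_div lef_pV2 ?posrE ?divr_gt0 ?powR_gt0//.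
  apply: le_trans e_lo; rewrite ler_pM2l// powRN lef_pV2 ?posrE ?powR_gt0//.
  by rewrite ge0_ler_powR ?nnegrE ?(ltW H0) ?(ltW Hq) ?ler0n.
apply: (@le_trans _ _ ((2 * e * L%:R + 1) * (5 * (4 * (d / e))))).
  by apply: ler_pM => //; [rewrite lerD2r | rewrite ler_pM2l].
have -> : (2 * e * L%:R + 1) * (5 * (4 * (d / e))) = 40 * (L%:R * d) + 20 * (d / e).
  by field; rewrite gt_eqF.
lra.
Qed.

(** * Floor sums on average over k-th powers *)

Section BadModuli.
Variables (R : realType) (g : R) (Y : nat).

(* Some [q D g] is so close to an integer that the floor sums along the multiples
   of [D] may deviate by more than [V log Y] from their mean. *)
Definition bad (D V : nat) : bool :=
  [exists q : 'I_Y.+1, [&& (0 < q)%N, (q * V * D <= Y)%N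
     & dint ((q * D)%:R * g) <= (q * V)%:R^-1]].

Lemma bad_small D V : bad D V -> (0 < D)%N -> (V <= Y)%N.
Proof.
move=> /existsP[q /and3P[q0 qY _]] D0; apply: leq_trans qY.
by rewrite -[leqLHS]mul1n -[leqLHS]muln1 leq_mul// leq_mul.
Qed.

(** If the hypothesis of [floor_gap_le] failed, some approximation would have [q V < M' <= Y / D]
    and error at most [1 / M' < 1 / (q V)], which makes [D] bad. *)
Lemma floor_gap_good D V c c' : (0 < D)%N -> (0 < V)%N -> ~~ bad D V ->
  `|floor_gap (- (D%:R * g)) c c' (Y %/ D)|
    <= 4 * V%:R * (trunc_log 2 Y).+1%:R.
Proof.
move=> D0 V0 nb; apply: (@le_trans _ _ (4 * V%:R * (trunc_log 2 (Y %/ D)).+1%:R)).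
  apply: floor_gap_le => M' q a /andP[q0 qM'] M'Y qa.
  rewrite leqNgt; apply: contra nb => VqM'.
  have qVDY : (q * V * D <= Y)%N.
    by rewrite -leq_divRL// [(q * V)%N]mulnC (leq_trans (ltnW VqM')).
  have qY : (q < Y.+1)%N.
    by rewrite ltnS (leq_trans _ qVDY)// -mulnA leq_pmulr// muln_gt0 V0.
  apply/existsP; exists (Ordinal qY); rewrite /= q0 qVDY /=.
  apply: le_trans (dint_le _ (- a)) _.
  have -> : (q * D)%:R * g - (- a)%:~R = - (q%:R * - (D%:R * g) - a%:~R) :> R.
    by rewrite natrM intrN; ring.
  rewrite normrN; apply: (le_trans qa).
  rewrite lef_pV2 ?posrE ?ltr0n ?muln_gt0 ?q0 ?V0 ?(leq_trans q0 qM')//.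
  by rewrite ler_nat mulnC ltnW.
by rewrite ler_wpM2l ?mulr_ge0// ler_nat ltnS leq_trunc_log// leq_div.
Qed.

(** Apply the previous bound at the least good level [2 ^ j]. For [j > 0] the level below is bad and
    its term already equals [2 ^ j]; the summand 1 covers [j = 0]. *)
Lemma floor_gap_layers D c c' : (0 < D)%N ->
  `|floor_gap (- (D%:R * g)) c c' (Y %/ D)| <= 4 * (trunc_log 2 Y).+1%:R *
    (1 + \sum_(0 <= j < (trunc_log 2 Y).+1) 2 ^+ j.+1 * (bad D (2 ^ j))%:R).
Proof.
move=> D0; set I := (trunc_log 2 Y).+1.
have ex : exists j, ~~ bad D (2 ^ j).
  exists I; apply/negP => /bad_small/(_ D0); apply/negP.
  by rewrite -ltnNge trunc_log_ltn.
have [j nb jmin] := ex_minnP ex.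
have jI : (j <= I)%N.
  by apply: jmin; apply/negP => /bad_small/(_ D0); apply/negP; rewrite -ltnNge trunc_log_ltn.
have V0 : (0 < 2 ^ j)%N by rewrite expn_gt0.
apply: le_trans (floor_gap_good c c' D0 V0 nb) _.
rewrite -/I mulrAC ler_wpM2l ?mulr_ge0//.
have pos i : 0 <= 2 ^+ i.+1 * (bad D (2 ^ i))%:R :> R by rewrite mulr_ge0 ?exprn_ge0.
case: j nb jmin jI V0 => [|j] nb jmin jI V0.
  by rewrite expn0 lerDl sumr_ge0.
rewrite (@big_cat_nat _ _ _ j) ?(ltnW jI)//= [X in 1 + (_ + X)]big_ltn//.
have -> : bad D (2 ^ j) = true.
  by case E : (bad D (2 ^ j)) => //; have := jmin j; rewrite E ltnn => /(_ isT).
rewrite mulr1 natrX.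
have : 0 <= \sum_(0 <= i < j) 2 ^+ i.+1 * (bad D (2 ^ i))%:R :> R by apply: sumr_ge0.
have : 0 <= \sum_(j.+1 <= i < I) 2 ^+ i.+1 * (bad D (2 ^ i))%:R :> R by apply: sumr_ge0.
lra.
Qed.

End BadModuli.

(** * Counting bad k-th powers *)

Lemma count_dyadic (P : pred nat) (I : nat) :
  count P (iota 1 (2 ^ I).-1) = (\sum_(0 <= i < I) count P (iota (2 ^ i) (2 ^ i)))%N.
Proof.
elim: I => [|I IH]; first by rewrite big_geq.
rewrite big_nat_recr//= -IH -count_cat; congr count.
have p : (0 < 2 ^ I)%N by rewrite expn_gt0.
have -> : iota (2 ^ I) (2 ^ I) = iota (1 + (2 ^ I).-1) (2 ^ I) by rewrite add1n prednK.
by rewrite -iotaD; congr iota; rewrite expnS; lia.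
Qed.

(** Bounds the number of moduli [d ^ k] that a single [l = q * d ^ k] can make bad. *)
Lemma size_kth_divisors k z l : (0 < k)%N -> (0 < l)%N ->
  (\sum_(1 <= d < z.+1 | (d ^ k %| l)%N) 1 <= size (divisors l))%N.
Proof.
move=> k0 l0; rewrite sum1_count -size_filter; apply: uniq_leq_size.
  by rewrite filter_uniq// iota_uniq.
move=> d; rewrite mem_filter -dvdn_divisors// => /andP[dl _].
by apply: dvdn_trans dl; rewrite -{1}(expn1 d) dvdn_exp2l.
Qed.

Section CountBadModuli.
Variables (R : realType) (g c th : R).
Hypotheses (c0 : 0 < c) (th0 : 0 <= th).
Hypothesis cg : forall l, (0 < l)%N -> c * l%:R `^ (- th) <= dint (l%:R * g).
Variables (Y k z : nat) (H : R) (T : R).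
Hypotheses (Y0 : (0 < Y)%N) (k0 : (0 < k)%N) (z0 : (0 < z)%N) (H0 : 0 < H).
Hypothesis TP : forall l, (0 < l <= Y)%N -> (size (divisors l))%:R <= T.

Let W := Y%:R / H + (z ^ k)%:R + H `^ th / c.

(** What badness of [d ^ k] implies for [l = q * d ^ k] alone: [1 / q] is at most 1, and at most
    [z ^ k / l] because [d <= z]. *)
Let P (V l : nat) : bool := (l * V <= Y)%N &&
  (dint (l%:R * g) <= Num.min 1 ((z ^ k)%:R / l%:R) / V%:R).

Let W_ge1 : 1 <= W.
Proof.
rewrite /W; have h1 : 0 <= Y%:R / H by rewrite divr_ge0// ltW.
have h2 : 0 <= H `^ th / c by rewrite divr_ge0 ?powR_ge0// ltW.
have : 1 <= (z ^ k)%:R :> R by rewrite ler1n expn_gt0 z0.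
lra.
Qed.

Let T_ge1 : 1 <= T.
Proof. by apply: le_trans (TP (l := 1%N) _); rewrite ?Y0. Qed.

Let count_P_dyadic V i : (0 < V)%N ->
  (count (P V) (iota (2 ^ i) (2 ^ i)))%:R <= 120 * W / V%:R :> R.
Proof.
move=> V0; have VR : 0 < V%:R :> R by rewrite ltr0n.
have W0 := lt_le_trans ltr01 W_ge1.
(* The summand 1 in [count_near_int] is not bounded by [W / V] for arbitrary [V]; empty blocks are
   therefore set apart, and a point in a nonempty block bounds [V]. *)
have [|none] := boolP (has (P V) (iota (2 ^ i) (2 ^ i))); last first.
  by move: none; rewrite has_count -leqNgt leqn0 => /eqP ->; rewrite divr_ge0 ?mulr_ge0 ?ltW.
move=> /hasP[l]; rewrite mem_iota => /andP[il li] /andP[lV dl].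
have p0 : (0 < 2 ^ i)%N by rewrite expn_gt0.
have l0 : (0 < l)%N := leq_trans p0 il.
have lR : 0 < l%:R :> R by rewrite ltr0n.
have pR : 0 < (2 ^ i)%:R :> R by rewrite ltr0n.
set Z : R := (z ^ k)%:R in dl *.
have Z0 : 0 < Z by rewrite ltr0n expn_gt0 z0.
pose d := Num.min 1 (Z / (2 ^ i)%:R) / V%:R.
have m0 : 0 < Num.min 1 (Z / (2 ^ i)%:R) by rewrite lt_min ltr01 divr_gt0.
have d0 : 0 < d by rewrite divr_gt0.
have dV : d <= V%:R^-1 by rewrite -[leRHS]mul1r ler_wpM2r ?invr_ge0 ?ler0n// ge_min lexx.
have d1 : d <= 1 by apply: (le_trans dV); rewrite invf_le1// ler1n.
have iV : (2 ^ i * V <= Y)%N by apply: leq_trans lV; rewrite leq_mul2r il orbT.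
have sub : (count (P V) (iota (2 ^ i) (2 ^ i)) <=
    count (fun l => (dint (l%:R * g) <= d)%R) (iota 1 (2 ^ i.+1)))%N.
  rewrite -!size_filter; apply: uniq_leq_size; first by rewrite filter_uniq// iota_uniq.
  move=> x; rewrite !mem_filter !mem_iota => /andP[/andP[_ dx] /andP[ix xi]].
  have x0 : (0 < x)%N := leq_trans p0 ix.
  rewrite x0 add1n ltnS expnS mul2n -addnn (ltnW xi) !andbT.
  apply: (le_trans dx); rewrite ler_pM2r ?invr_gt0// le_min ge_min lexx /=.
  rewrite ge_min; apply/orP; right; rewrite ler_pM2l// lef_pV2 ?posrE ?ler_nat//.
  by rewrite ltr0n.
rewrite -(ler_nat R) in sub; apply: (le_trans sub).
have d01 : 0 < d <= 1 by rewrite d0.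
apply: le_trans (count_near_int c0 th0 cg _ d01 H0) _.
(* If [l <= H], the Diophantine bound at [l] gives [V <= l ^ th / c]; if [l > H], then [l V <= Y]
   gives [V <= Y / H]. *)
have V1 : 1 <= (H `^ th / c + Y%:R / H) / V%:R.
  rewrite ler_pdivlMr// mul1r.
  have h1 : 0 <= Y%:R / H by rewrite divr_ge0// ltW.
  have h2 : 0 <= H `^ th / c by rewrite divr_ge0 ?powR_ge0// ltW.
  have [lH|Hl] := leP l%:R H.
    suff : V%:R <= H `^ th / c by lra.
    have hV : c * l%:R `^ (- th) <= V%:R^-1.
      apply: le_trans (cg l0) (le_trans dl _).
      by rewrite -[leRHS]mul1r ler_wpM2r ?invr_ge0 ?ler0n// ge_min lexx.
    rewrite powRN ler_pdivrMr ?powR_gt0// -ler_pdivrMl ?invr_gt0// invrK in hV.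
    rewrite ler_pdivlMr//; apply: (le_trans hV).
    by rewrite ge0_ler_powR ?nnegrE ?(ltW H0) ?ler0n.
  suff : V%:R <= Y%:R / H by lra.
  rewrite ler_pdivlMr//; apply: (@le_trans _ _ (V%:R * l%:R)).
    by rewrite ler_pM2l// ltW.
  by rewrite -natrM ler_nat mulnC.
have b1 : (2 ^ i.+1)%:R / H <= 2 * (Y%:R / H) / V%:R.
  rewrite mulrA mulrAC ler_pM2r ?invr_gt0// ler_pdivlMr// -!natrM ler_nat.
  by rewrite expnS -mulnA leq_mul2l.
have b2 : (2 ^ i.+1)%:R * d <= 2 * Z / V%:R.
  rewrite /d mulrA ler_pM2r ?invr_gt0// expnS natrM -mulrA ler_pM2l//.
  apply: (@le_trans _ _ ((2 ^ i)%:R * (Z / (2 ^ i)%:R))).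
    by rewrite ler_pM2l// ge_min lexx orbT.
  by rewrite mulrCA mulfV ?mulr1// gt_eqF.
have b3 : d * H `^ th / c <= H `^ th / c / V%:R.
  by rewrite -mulrA mulrC ler_wpM2l// divr_ge0 ?powR_ge0// ltW.
rewrite /W -/Z.
have -> : 120 * (Y%:R / H + Z + H `^ th / c) / V%:R =
  120 * (Y%:R / H / V%:R) + 120 * (Z / V%:R) + 120 * (H `^ th / c / V%:R) by ring.
rewrite mulrDl in V1; rewrite -!mulrA in V1 b1 b2 b3 *.
have h1 : 0 <= Y%:R / H / V%:R by rewrite !divr_ge0// ltW.
have h2 : 0 <= H `^ th / c / V%:R by rewrite !divr_ge0 ?powR_ge0// ltW.
have h3 : 0 <= Z / V%:R by rewrite !divr_ge0// ltW.
rewrite -!mulrA in h1 h2 h3; lra.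
Qed.

(** Each bad [d] yields some [l] with [P V l]; each [l] serves at most [T] values of [d], and the
    [l] fill at most [trunc_log 2 Y + 1] dyadic blocks. *)
Lemma count_bad V : (0 < V)%N ->
  \sum_(1 <= d < z.+1) (bad g Y (d ^ k) V)%:R <=
    120 * T * (trunc_log 2 Y).+1%:R * W / V%:R :> R.
Proof.
move=> V0; have VR : 0 < V%:R :> R by rewrite ltr0n.
set I := (trunc_log 2 Y).+1.
apply: (@le_trans _ _ (\sum_(1 <= d < z.+1) \sum_(1 <= l < Y.+1 | (d ^ k %| l)%N) (P V l)%:R)).
  rewrite !big_nat; apply: ler_sum => d /andP[d0 dz].
  have D0 : (0 < d ^ k)%N by rewrite expn_gt0 d0.
  have [/existsP[q /and3P[q0 qY dq]]|_] := boolP (bad _ _ _ _); last first.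
    by apply: sumr_ge0 => l _.
  have lY : (q * d ^ k < Y.+1)%N.
    rewrite ltnS; apply: leq_trans qY; rewrite leq_mul2r -[leqLHS]muln1.
    by rewrite leq_mul2l V0 !orbT.
  have l0 : (0 < q * d ^ k)%N by rewrite muln_gt0 q0.
  rewrite big_mkcond (bigD1_seq (q * d ^ k)%N) ?iota_uniq//=; last first.
    by rewrite mem_index_iota l0.
  rewrite dvdn_mull//; suff -> : P V (q * d ^ k).
    by rewrite lerDl sumr_ge0// => l _; case: ifP.
  rewrite /P mulnAC qY /=; apply: (le_trans dq).
  have qR : 0 < q%:R :> R by rewrite ltr0n.
  have DR : 0 < (d ^ k)%:R :> R by rewrite ltr0n.
  rewrite natrM invfM ler_pM2r ?invr_gt0// le_min invf_le1// ler1n q0 /=.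
  rewrite natrM ler_pdivlMr ?mulr_gt0// mulKf ?gt_eqF// ler_nat.
  by rewrite leq_exp2r// -ltnS.
under eq_bigr do rewrite big_mkcond.
rewrite exchange_big /=.
apply: (@le_trans _ _ (\sum_(1 <= l < Y.+1) (P V l)%:R * T)).
  rewrite !big_nat; apply: ler_sum => l lY; rewrite -big_mkcond /=.
  have -> : \sum_(1 <= d < z.+1 | (d ^ k %| l)%N) (P V l)%:R =
      (P V l)%:R * (\sum_(1 <= d < z.+1 | (d ^ k %| l)%N) 1)%:R :> R.
    by rewrite natr_sum mulr_sumr; apply: eq_bigr => d _; rewrite mulr1.
  rewrite ler_wpM2l//.
  apply: le_trans (TP lY); rewrite ler_nat; apply: size_kth_divisors => //.
  by case/andP: lY.
rewrite -mulr_suml.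
have cP : \sum_(1 <= l < Y.+1) (P V l)%:R <= I%:R * (120 * W / V%:R).
  have -> : \sum_(1 <= l < Y.+1) (P V l)%:R = (count (P V) (iota 1 Y))%:R :> R.
    rewrite -sum1_count natr_sum [RHS]big_mkcond /index_iota subn1 /=.
    by apply: eq_bigr => l _; case: (P V l).
  apply: (@le_trans _ _ (count (P V) (iota 1 (2 ^ I).-1))%:R).
    have YI : (Y <= (2 ^ I).-1)%N by rewrite -ltnS prednK ?expn_gt0// trunc_log_ltn.
    rewrite ler_nat -(subnKC YI) iotaD count_cat leq_addr//.
  rewrite count_dyadic natr_sum.
  apply: (@le_trans _ _ (\sum_(0 <= i < I) 120 * W / V%:R)).
    by apply: ler_sum => i _; exact: count_P_dyadic.
  by rewrite sumr_const_nat subn0 [leRHS]mulr_natl.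
apply: le_trans (ler_wpM2r (le_trans ler01 T_ge1) cP) _.
by rewrite le_eqVlt; apply/orP; left; apply/eqP; ring.
Qed.

Lemma sum_floor_gap (cc cc' : nat -> R) :
  \sum_(1 <= d < z.+1) `|floor_gap (- ((d ^ k)%:R * g)) (cc d) (cc' d) (Y %/ d ^ k)|
  <= 964 * T * (trunc_log 2 Y).+1%:R ^+ 3 * W.
Proof.
set I := (trunc_log 2 Y).+1.
apply: (@le_trans _ _ (\sum_(1 <= d < z.+1) (4 * I%:R *
    (1 + \sum_(0 <= j < I) 2 ^+ j.+1 * (bad g Y (d ^ k) (2 ^ j))%:R)))).
  rewrite !big_nat; apply: ler_sum => d /andP[d0 _].
  by apply: floor_gap_layers; rewrite expn_gt0 d0.
rewrite -mulr_sumr big_split /= exchange_big /= sumr_const_nat subSS subn0.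
have I1 : 1 <= I%:R :> R by rewrite ler1n.
have layer : \sum_(0 <= j < I) \sum_(1 <= d < z.+1) 2 ^+ j.+1 * (bad g Y (d ^ k) (2 ^ j))%:R
    <= I%:R * (240 * T * I%:R * W).
  apply: (@le_trans _ _ (\sum_(0 <= j < I) (240 * T * I%:R * W))); last first.
    by rewrite sumr_const_nat subn0 [leRHS]mulr_natl.
  apply: ler_sum => j _.
  rewrite -mulr_sumr; have p0 : (0 < 2 ^ j)%N by rewrite expn_gt0.
  have pR : 0 < 2 ^+ j :> R by rewrite exprn_gt0.
  (* The cost [2 ^ (j + 1)] cancels against the frequency [1 / 2 ^ j], so the bound is the same for
     every layer. *)
  apply: le_trans (ler_wpM2l (exprn_ge0 _ (ler0n _ _)) (count_bad p0)) _.
  rewrite natrX exprS le_eqVlt; apply/orP; left; apply/eqP; rewrite -/I.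
  by field; rewrite gt_eqF.
have zW : z%:R <= W.
  rewrite /W; have h1 : 0 <= Y%:R / H by rewrite divr_ge0// ltW.
  have h2 : 0 <= H `^ th / c by rewrite divr_ge0 ?powR_ge0// ltW.
  have : z%:R <= (z ^ k)%:R :> R by rewrite ler_nat -{1}(expn1 z) leq_pexp2l.
  lra.
rewrite -mulr_natl mulr1.
apply: (@le_trans _ _ (4 * I%:R * (W + I%:R * (240 * T * I%:R * W)))).
  by rewrite ler_wpM2l ?mulr_ge0// lerD.
have -> : 4 * I%:R * (W + I%:R * (240 * T * I%:R * W)) =
   4 * (I%:R * W) + 960 * (T * I%:R ^+ 3 * W) by ring.
have W0 : 0 <= W := le_trans ler01 W_ge1.
have : I%:R * W <= T * I%:R ^+ 3 * W.
  rewrite ler_wpM2r// -[leLHS]mul1r ler_pM// ?(le_trans ler01)//.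
  by rewrite -[leLHS]expr1 ler_weXn2l.
set x := T * I%:R ^+ 3 * W; have -> : 964 * T * I%:R ^+ 3 * W = 964 * x by rewrite /x; ring.
lra.
Qed.

End CountBadModuli.

(** * Irrationality type *)

Lemma dint_le_half (R : realType) (x : R) : dint x <= 2^-1.
Proof.
have := floor_itv (x + 2^-1); rewrite /dint -/(near_int x) intrD => /andP[lo hi].
by rewrite ler_norml; move: lo hi; lra.
Qed.

Lemma dist_intE (R : realType) (x : R) : dist_int x = dint x.
Proof.
apply/eqP; rewrite eq_le; apply/andP; split.
  apply: ge_inf; first by exists 0 => _ [m _ <-].
  by exists (near_int x).
apply: lb_le_inf; first by exists `|x - 0%:~R|; exists 0.
by move=> _ [m _ <-]; exact: dint_le.
Qed.

Lemma dint_irrational_gt0 (R : realType) (alpha : R) q : irrational alpha ->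
  (0 < q)%N -> 0 < dint (alpha * q%:R).
Proof.
move=> irr q0; rewrite normr_gt0 subr_eq0; apply/eqP => E; apply: irr.
apply/rationalP; exists (near_int (alpha * q%:R)), q.
by rewrite -E mulfK// pnatr_eq0 -lt0n.
Qed.

Lemma pos_lower_bound (R : realFieldType) (v : nat -> R) n :
  (forall m, (0 < m)%N -> 0 < v m) ->
  exists2 c, 0 < c & forall m, (0 < m < n)%N -> c <= v m.
Proof.
move=> v0; elim: n => [|n [c c0 cP]]; first by exists 1 => // m; rewrite ltn0 andbF.
case: (posnP n) => n0.
  by exists 1 => // m; rewrite n0 ltnS leqn0 => /andP[/lt0n_neq0/negPf->].
exists (Num.min c (v n)) => [|m /andP[m0]]; first by rewrite lt_min c0 v0.
rewrite ltnS leq_eqVlt ge_min => /orP[/eqP ->|mn]; first by rewrite lexx orbT.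
by rewrite cP// m0.
Qed.

(** Since [th] exceeds the supremum, the lower limit at [th] is not 0, so some tail has a positive
    infimum. The finitely many earlier terms are positive by irrationality. *)
Lemma irr_type_lower_bound (R : realType) (alpha tau th : R) :
  irrational alpha -> irr_type alpha = tau%:E -> tau < th ->
  exists2 c : R, 0 < c &
    forall q, (0 < q)%N -> c * q%:R `^ (- th) <= dint (alpha * q%:R).
Proof.
move=> irr tauE tau_th.
pose u (q : nat) : R := q%:R `^ th * dist_int (alpha * q%:R).
have u0 q : 0 <= u q by rewrite /u mulr_ge0 ?powR_ge0// dist_intE normr_ge0.
have v0 q : (0 < q)%N -> 0 < u q.
  move=> q0; rewrite /u dist_intE mulr_gt0 ?powR_gt0 ?ltr0n//.
  exact: dint_irrational_gt0.
have ne : limn_einf (fun q => (u q)%:E) <> 0%E.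
  move=> E0; have : (th%:E <= tau%:E)%E.
    by rewrite -tauE; apply: ereal_sup_ubound; exists th.
  by rewrite lee_fin leNgt tau_th.
have [n nP] : exists n, einfs (fun q => (u q)%:E) n <> 0%E.
  apply: contrapT => H; apply: ne; rewrite limn_einf_lim.
  have -> : einfs (fun q => (u q)%:E) = fun=> 0%E.
    by apply/funext => n; apply: contrapT => nP; apply: H; exists n.
  exact: lim_cst.
have e0 : (0 <= einfs (fun q => (u q)%:E) n)%E.
  by apply: le_ereal_inf_tmp => _ [m _ <-]; rewrite lee_fin.
have eu m : (n <= m)%N -> (einfs (fun q => (u q)%:E) n <= (u m)%:E)%E.
  by move=> nm; apply: ereal_inf_lbound; exists m.
have [r r0 ru] : exists2 r, 0 < r & forall m, (n <= m)%N -> r <= u m.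
  case E : (einfs _ n) nP e0 eu => [r||] nP e0 eu //.
    exists r; last by move=> m /eu; rewrite lee_fin.
    by move: e0; rewrite lee_fin le_eqVlt => /orP[/eqP r0|//]; rewrite -r0 in nP.
  by have := eu n (leqnn n).
have [s s0 su] := pos_lower_bound n v0.
exists (Num.min r s); first by rewrite lt_min r0.
move=> q q0; rewrite powRN ler_pdivrMr ?powR_gt0 ?ltr0n// mulrC.
rewrite -dist_intE -/(u q) ge_min.
by case: (leqP n q) => nq; [rewrite ru | rewrite su ?orbT// q0].
Qed.

(** A negative type would give a lower bound for [dint] growing with [q], although [dint] never
    exceeds 1/2. *)
Lemma irr_type_ge0 (R : realType) (alpha tau : R) :
  irrational alpha -> irr_type alpha = tau%:E -> 0 <= tau.
Proof.
move=> irr tauE; rewrite leNgt; apply/negP => tau0.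
have th_gt : tau < tau / 2 by lra.
have [c c0 cP] := irr_type_lower_bound irr tauE th_gt.
have t0 : 0 < - (tau / 2) by lra.
pose q := (Num.truncn (c^-1 `^ (- (tau / 2))^-1)).+1.
have : c^-1 <= q%:R `^ (- (tau / 2)).
  have e1 : c^-1 = (c^-1 `^ (- (tau / 2))^-1) `^ (- (tau / 2)).
    by rewrite -powRrM mulVf ?gt_eqF// powRr1// invr_ge0 ltW.
  rewrite [leLHS]e1 ge0_ler_powR ?nnegrE ?powR_ge0 ?(ltW t0)//.
  exact: ltW (truncnS_gt _).
rewrite -(ler_pM2l c0) mulfV ?gt_eqF// => h.
have := le_trans h (le_trans (cP q isT) (dint_le_half _)); lra.
Qed.

(** With [h] nearest to [l / alpha], [|l / alpha - h| = |h alpha - l| / alpha], and [h <= 2 l] turns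
    the bound at [h] into one at [l]. The case [h = 0] is covered by the term [alpha^-1] of the
    minimum. *)
Lemma dint_inv_lower_bound (R : realType) (alpha c th : R) : 1 < alpha ->
  0 < c -> 0 <= th ->
  (forall q, (0 < q)%N -> c * q%:R `^ (- th) <= dint (alpha * q%:R)) ->
  exists2 c', 0 < c' &
    forall l, (0 < l)%N -> c' * l%:R `^ (- th) <= dint (l%:R * alpha^-1).
Proof.
move=> a1 c0 th0 cP; have a0 : 0 < alpha := lt_trans ltr01 a1.
exists (Num.min alpha^-1 (c * 2 `^ (- th) / alpha)).
  by rewrite lt_min invr_gt0 a0 divr_gt0// mulr_gt0// powR_gt0.
move=> l l0; have l1 : 1 <= l%:R :> R by rewrite ler1n.
have lth : l%:R `^ (- th) <= 1.
  by apply: le_trans (ler_powR l1 (_ : - th <= 0)) _; rewrite ?oppr_le0 ?powRr0.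
have half := dint_le_half (l%:R * alpha^-1).
case E : (near_int (l%:R * alpha^-1)) => [h|h]; last first.
  exfalso; move: half; rewrite /dint E NegzE mulrNz opprK ger0_norm; last first.
    by rewrite addr_ge0// divr_ge0// ltW.
  have : 0 < l%:R * alpha^-1 by rewrite divr_gt0// (lt_le_trans ltr01).
  have : 1 <= h.+1%:R :> R by rewrite ler1n.
  rewrite -[h.+1%:~R]/(h.+1%:R); lra.
rewrite /dint E -[h%:Z%:~R]/(h%:R).
case: (posnP h) => h0.
  rewrite h0 subr0 ger0_norm ?divr_ge0 ?(ltW a0)//.
  apply: (@le_trans _ _ (alpha^-1 * 1)).
    rewrite ler_pM ?powR_ge0 ?ge_min ?lexx// le_min invr_ge0 (ltW a0).
    by rewrite divr_ge0 ?mulr_ge0 ?powR_ge0 ?(ltW c0) ?(ltW a0).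
  by rewrite mulrC ler_wpM2r// invr_ge0 ltW.
have hl : h%:R <= 2 * l%:R :> R.
  move: half; rewrite /dint E -[h%:Z%:~R]/(h%:R) ler_norml => /andP[lo _].
  have : l%:R * alpha^-1 <= l%:R by rewrite ler_pdivrMr// ler_peMr// ltW.
  lra.
apply: (@le_trans _ _ (c * h%:R `^ (- th) / alpha)).
  apply: (@le_trans _ _ (c * 2 `^ (- th) / alpha * l%:R `^ (- th))).
    by rewrite ler_wpM2r ?powR_ge0// ge_min lexx orbT.
  rewrite mulrAC ler_pM2r ?invr_gt0// -mulrA ler_pM2l// -powRM//.
  rewrite !powRN lef_pV2 ?posrE ?powR_gt0 ?ltr0n ?mulr_gt0 ?(lt_le_trans ltr01 l1)//.
  by rewrite ge0_ler_powR ?nnegrE ?mulr_ge0.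
rewrite ler_pdivrMr//; apply: (le_trans (cP h h0)).
apply: (le_trans (dint_le _ l%:Z)); rewrite -[l%:Z%:~R]/(l%:R) distrC.
rewrite -{3}(gtr0_norm a0) -normrM mulrBl mulfVK ?gt_eqF//.
by rewrite [h%:R * _]mulrC.
Qed.

(** * Counting k-free values of a Beatty sequence *)

Lemma floor_truncn (R : realType) (x : R) : 0 <= x ->
  Num.floor x = (Num.truncn x)%:Z.
Proof.
move=> x0; apply: floor_def; have /andP[lo hi] := truncn_itv x0.
by rewrite -[(Num.truncn x)%:Z%:~R]/((Num.truncn x)%:R) lo intrD natr1.
Qed.

Section Beatty.
Variables (R : realType) (alpha beta : R).
Hypothesis alpha1 : 1 < alpha.

(* The number of integers [n] with [floor (alpha * n + beta) = l]. *)
Definition hit (l : nat) : int :=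
  Num.floor ((beta - l%:R) / alpha) - Num.floor ((beta - 1 - l%:R) / alpha).

Let alpha0 : 0 < alpha. Proof. exact: lt_trans ltr01 alpha1. Qed.

Let floor_quot (x : R) (m : int) : m%:~R * alpha <= x -> x < (m + 1)%:~R * alpha ->
  Num.floor (x / alpha) = m.
Proof. by move=> lo hi; apply: floor_def; rewrite ler_pdivlMr// ltr_pdivrMr// lo. Qed.

(** The admissible [n] lie in a half-open interval of length [1 / alpha < 1]. *)
Lemma hit_ge0_le1 l : 0 <= hit l <= 1.
Proof.
rewrite /hit; apply/andP; split.
  by rewrite subr_ge0 le_floor// ler_pM2r ?invr_gt0//; lra.
have a1 := alpha1.
rewrite lerBlDr addrC -ltzD1 -(ltr_int R); apply: (le_lt_trans (floor_le _)).
have := floorD1_gt ((beta - 1 - l%:R) / alpha); rewrite !intrD.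
have : (beta - l%:R) / alpha < (beta - 1 - l%:R) / alpha + 1.
  by rewrite -ltrBlDl -mulrBl ltr_pdivrMr//; lra.
lra.
Qed.

Lemma hit1 (n l : nat) : l%:R <= alpha * n%:R + beta -> alpha * n%:R + beta < l.+1%:R ->
  hit l = 1.
Proof.
have a1 := alpha1; rewrite -natr1 => lo hi; rewrite /hit (@floor_quot _ (- n%:Z)); first last.
- by rewrite intrD intrN -[n%:Z%:~R]/(n%:R); lra.
- by rewrite intrN -[n%:Z%:~R]/(n%:R); lra.
rewrite (@floor_quot _ (- n%:Z - 1)); first by ring.
- by rewrite intrB intrN -[n%:Z%:~R]/(n%:R); lra.
- by rewrite subrK intrN -[n%:Z%:~R]/(n%:R); lra.
Qed.

Lemma hit0 (n l : nat) : alpha * n%:R + beta < l%:R ->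
  l.+1%:R <= alpha * n.+1%:R + beta -> hit l = 0.
Proof.
have a1 := alpha1; rewrite -!natr1 => lo hi; rewrite /hit.
have nE : (- n.+1%:Z)%:~R = - n%:R - 1 :> R.
  by rewrite intrN -[n.+1%:Z%:~R]/(n.+1%:R) -natr1; ring.
rewrite !(@floor_quot _ (- n.+1%:Z)) ?subrr// ?intrD nE; lra.
Qed.

(** Change of variable from indices to values: values strictly increase as [alpha > 1], and the
    integers skipped between consecutive ones have [hit] equal to 0. *)
Lemma sum_hit (f : nat -> R) (n0 N : nat) : 0 <= alpha * n0%:R + beta -> (n0 <= N)%N ->
  \sum_(n0.+1 <= n < N.+1) f (Num.truncn (alpha * n%:R + beta)) =
  \sum_((Num.truncn (alpha * n0%:R + beta)).+1 <= l <
          (Num.truncn (alpha * N%:R + beta)).+1) f l * (hit l)%:~R.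
Proof.
move=> h0; elim: N => [|N IH].
  by rewrite leqn0 => /eqP ->; rewrite !big_geq.
rewrite leq_eqVlt => /orP[/eqP -> |]; first by rewrite !big_geq.
rewrite ltnS => nN; pose y n := alpha * n%:R + beta.
have mono m n : (m <= n)%N -> y m <= y n.
  by move=> mn; rewrite lerD2r ler_pM2l// ler_nat.
have yN0 : 0 <= y N := le_trans h0 (mono _ _ nN).
have yS0 : 0 <= y N.+1 := le_trans yN0 (mono _ _ (leqnSn N)).
have /andP[a1 a2] := truncn_itv yN0; have /andP[b1 b2] := truncn_itv yS0.
have lt_trunc : (Num.truncn (y N) < Num.truncn (y N.+1))%N.
  rewrite truncn_gt_nat -natr1 /y -[N.+1%:R]natr1 mulrDr mulr1; rewrite -/(y N).
  by move: alpha1 a1; rewrite /y; lra.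
rewrite big_nat_recr//= IH// -/(y n0) -/(y N) -/(y N.+1).
rewrite [RHS](@big_cat_nat _ _ _ (Num.truncn (y N)).+1)//=; last first.
- by rewrite ltnS ltnW.
- by rewrite ltnS le_truncn// mono.
congr (_ + _); rewrite big_nat_recr//= (@hit1 N.+1)// mulr1.
rewrite big_nat_cond big1 ?add0r// => l; rewrite andbT => /andP[lo hi].
rewrite (@hit0 N) ?mulr0//; first by apply: lt_le_trans a2 _; rewrite ler_nat.
by apply: le_trans b1; rewrite ler_nat.
Qed.

Lemma sum_hit_multiples D M :
  \sum_(1 <= m < M.+1) (hit (D * m))%:~R =
  floor_gap (- (D%:R * alpha^-1)) (beta / alpha - D%:R / alpha)
    ((beta - 1) / alpha - D%:R / alpha) M + M%:R / alpha.
Proof.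
(* [floor_gap] starts at [m = 0] and the multiples at [m = 1], hence the shift by [- D / alpha] in
   both constants. *)
rewrite /floor_gap big_add1 /=.
have -> : beta / alpha - D%:R / alpha - ((beta - 1) / alpha - D%:R / alpha) = alpha^-1.
  by rewrite mulrBl div1r; ring.
rewrite subrK; apply: eq_bigr => m _; congr ((_ - _)%:~R); congr Num.floor.
  by rewrite natrM -natr1; ring.
by rewrite natrM -natr1; ring.
Qed.

(** * The sieve over k-th powers and the choice of parameters *)

Variables (k : nat) (c th eps : R).
Hypotheses (k2 : (2 <= k)%N) (c0 : 0 < c) (th0 : 0 <= th) (eps0 : 0 < eps).
Hypothesis cg : forall l, (0 < l)%N -> c * l%:R `^ (- th) <= dint (l%:R * alpha^-1).

Definition kfreeR (l : nat) : R := (l%:Z \in kfree k)%:R.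

Lemma sum_kfree_hit Y z : (0 < z <= Y)%N ->
  `|\sum_(1 <= l < Y.+1) kfreeR l * (hit l)%:~R - Y%:R / alpha / zeta k%:R| <=
  \sum_(1 <= d < z.+1) `|floor_gap (- ((d ^ k)%:R * alpha^-1))
      (beta / alpha - (d ^ k)%:R / alpha)
      ((beta - 1) / alpha - (d ^ k)%:R / alpha) (Y %/ d ^ k)| +
  z%:R + Y%:R / z%:R ^+ k.-1 * (1 + 2 ^+ k.-1 * (trunc_log 2 z).+1%:R).
Proof.
move=> /andP[z0 zY]; have k0 : (0 < k)%N := ltnW k2.
pose S d : R := \sum_(1 <= m < (Y %/ d ^ k).+1) (hit (d ^ k * m))%:~R.
have -> : \sum_(1 <= l < Y.+1) kfreeR l * (hit l)%:~R =
    \sum_(1 <= d < Y.+1) (mu d)%:~R * S d.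
  transitivity (\sum_(1 <= l < Y.+1) \sum_(1 <= d < Y.+1 | (d ^ k %| l)%N)
                  (mu d)%:~R * (hit l)%:~R : R).
    apply: eq_big_nat => l lY; rewrite -mulr_suml -rmorph_sum /=.
    by rewrite -(mem_kfreeE k0 lY) /kfreeR natz.
  under eq_bigr do rewrite big_mkcond.
  rewrite exchange_big /=; apply: eq_big_nat => d /andP[d0 _].
  rewrite -big_mkcond /= (sum_multiples _ (fun l => (mu d)%:~R * (hit l)%:~R)) ?expn_gt0 ?d0//.
  by rewrite -mulr_sumr.
have gap_alpha : 0 < alpha^-1 <= 1 by rewrite invr_gt0 alpha0 invf_le1// ltW.
have /andP[ia0 ia1] := gap_alpha.
have mu1R d : `|(mu d)%:~R| <= 1 :> R.
  by rewrite -intr_norm (ler_int R _ 1) norm_mu_le1.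
pose gap d := floor_gap (- ((d ^ k)%:R * alpha^-1)) (beta / alpha - (d ^ k)%:R / alpha)
      ((beta - 1) / alpha - (d ^ k)%:R / alpha) (Y %/ d ^ k).
pose P : R := \sum_(1 <= d < z.+1) (mu d)%:~R / d%:R ^+ k.
(* The summand [z] pays for rounding [Y / d ^ k] down, at most 1 for each [d]. *)
have small : `|\sum_(1 <= d < z.+1) (mu d)%:~R * S d - Y%:R / alpha * P| <=
    \sum_(1 <= d < z.+1) `|gap d| + z%:R.
  rewrite /P mulr_sumr -sumrB; apply: (le_trans (ler_norm_sum _ _ _)).
  have -> : z%:R = \sum_(1 <= d < z.+1) 1 :> R by rewrite sumr_const_nat subSS subn0.
  rewrite -big_split /= !big_nat; apply: ler_sum => d /andP[d0 _].
  have D0 : (0 < d ^ k)%N by rewrite expn_gt0 d0.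
  have DR : 0 < (d ^ k)%:R :> R by rewrite ltr0n.
  have -> : (mu d)%:~R * S d - Y%:R / alpha * ((mu d)%:~R / d%:R ^+ k) =
      (mu d)%:~R * (gap d + ((Y %/ d ^ k)%:R - Y%:R / (d ^ k)%:R) / alpha).
    rewrite /S sum_hit_multiples -/(gap d) natrX; ring.
  rewrite normrM -[leRHS]mul1r; apply: ler_pM => //.
  apply: (le_trans (ler_normD _ _)); rewrite lerD2l normrM (gtr0_norm ia0) -[leRHS]mul1r.
  apply: ler_pM => //; first by rewrite ltW.
  rewrite ler_norml; apply/andP; split.
    have : Y%:R / (d ^ k)%:R <= (Y %/ d ^ k)%:R + 1 :> R.
      rewrite ler_pdivrMr// natr1 -natrM ler_nat; exact: ltnW (ltn_ceil Y D0).
    lra.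
  have : (Y %/ d ^ k)%:R <= Y%:R / (d ^ k)%:R :> R.
    by rewrite ler_pdivlMr// -natrM ler_nat leq_divM.
  lra.
(* As [hit] is at most 1, [S d] is at most the number [Y / d ^ k] of multiples. *)
have large : `|\sum_(z.+1 <= d < Y.+1) (mu d)%:~R * S d| <= Y%:R / z%:R ^+ k.-1.
  apply: (le_trans (ler_norm_sum _ _ _)).
  apply: (@le_trans _ _ (\sum_(z.+1 <= d < Y.+1) Y%:R * (d%:R ^+ k)^-1)).
    rewrite !big_nat; apply: ler_sum => d /andP[zd _].
    have d0 : (0 < d)%N := leq_ltn_trans (leq0n _) zd.
    have D0 : (0 < d ^ k)%N by rewrite expn_gt0 d0.
    rewrite normrM -[leRHS]mul1r; apply: ler_pM => //.
    rewrite -natrX; apply: (@le_trans _ _ (Y %/ d ^ k)%:R); last first.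
      by rewrite ler_pdivlMr ?ltr0n// -natrM ler_nat leq_divM.
    have -> : (Y %/ d ^ k)%:R = \sum_(1 <= m < (Y %/ d ^ k).+1) 1 :> R.
      by rewrite sumr_const_nat subSS subn0.
    apply: (le_trans (ler_norm_sum _ _ _)); apply: ler_sum => m _.
    have /andP[h0 h1] := hit_ge0_le1 (d ^ k * m).
    by rewrite -intr_norm (ler_int R _ 1) ger0_norm.
  rewrite -mulr_sumr ler_wpM2l//.
  apply: (le_trans (sum_invXn_le R k2 _)); first by rewrite z0.
  by rewrite gerBl invr_ge0 exprn_ge0.
have Zb := sum_mu_div_zeta R k2 z0; rewrite -/P in Zb.
have main : `|Y%:R / alpha * P - Y%:R / alpha / zeta k%:R| <=
    Y%:R / z%:R ^+ k.-1 * (2 ^+ k.-1 * (trunc_log 2 z).+1%:R).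
  rewrite -mulrBr normrM ger0_norm ?divr_ge0 ?(ltW alpha0)//.
  have -> : Y%:R / z%:R ^+ k.-1 * (2 ^+ k.-1 * (trunc_log 2 z).+1%:R) =
    Y%:R * (2 ^+ k.-1 * (trunc_log 2 z).+1%:R / z%:R ^+ k.-1) :> R by ring.
  by apply: ler_pM => //; rewrite ?divr_ge0 ?(ltW alpha0)// ler_piMr.
rewrite (@big_cat_nat _ _ _ z.+1)//=.
set A := \sum_(1 <= d < z.+1) _ * _ in small *; set B := \sum_(z.+1 <= d < _) _ in large *.
have -> : A + B - Y%:R / alpha / zeta k%:R =
  (A - Y%:R / alpha * P) + B + (Y%:R / alpha * P - Y%:R / alpha / zeta k%:R) by ring.
apply: (le_trans (ler_normD _ _)).
have := ler_normD (A - Y%:R / alpha * P) B.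
rewrite mulrDr mulr1; move: small large main; rewrite /gap; lra.
Qed.

Lemma sum_kfree_hit_powR : exists2 C : R, 0 < C & forall Y, (0 < Y)%N ->
  `|\sum_(1 <= l < Y.+1) kfreeR l * (hit l)%:~R - Y%:R / alpha / zeta k%:R| <=
  C * (Y%:R `^ (k%:R / (2 * k%:R - 1) + eps) + Y%:R `^ (1 - 1 / (th + 1) + eps)).
Proof.
(* Four factors share [eps]: one divisor bound and the cube of the logarithm. *)
have e4 : 0 < eps / 4 by rewrite divr_gt0.
have [CT CT0 TP] := size_divisors_le_powR e4.
have [CI CI0 IP] := trunc_log_le_powR e4.
have k1 : 2 <= k%:R :> R by rewrite ler_nat.
have kk : 0 < 2 * k%:R - 1 :> R by lra.
have [K K0 KE] : exists2 K : R, 0 < K & 964 = K.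
  by exists 964; [rewrite ltr0n; exact: isT | reflexivity].
exists (K * CT * CI ^+ 3 * (1 + c^-1) + 1 + 2 ^+ k.-1 * (1 + 2 ^+ k.-1 * CI)).
  have ic : 0 < c^-1 by rewrite invr_gt0.
  have p2 : 0 < 2 ^+ k.-1 :> R by rewrite exprn_gt0.
  have h1 : 0 < K * CT * CI ^+ 3 * (1 + c^-1).
    by rewrite !mulr_gt0 ?exprn_gt0 ?addr_gt0.
  have h2 : 0 < 2 ^+ k.-1 * (1 + 2 ^+ k.-1 * CI) by rewrite mulr_gt0// addr_gt0// mulr_gt0.
  lra.
move=> Y Y0; have YR : 0 < Y%:R :> R by rewrite ltr0n.
have Y1 : 1 <= Y%:R :> R by rewrite ler1n.
pose y : R := Y%:R `^ (1 / (2 * k%:R - 1)).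
have y1 : 1 <= y by rewrite -(powRr0 (Y%:R : R)) ler_powR// divr_ge0// ltW.
have y0 : 0 <= y := le_trans ler01 y1.
pose z := Num.truncn y.
have z0 : (0 < z)%N by rewrite truncn_gt0.
have zR : 0 < z%:R :> R by rewrite ltr0n.
have /andP[zy yz] := truncn_itv y0; rewrite -/z in zy yz.
have zY : (z <= Y)%N.
  rewrite -(ler_nat R); apply: (le_trans zy).
  by rewrite ler1_powR// ler_pdivrMr//; lra.
pose A1 : R := Y%:R `^ (k%:R / (2 * k%:R - 1)).
pose A2 : R := Y%:R `^ (1 - 1 / (th + 1)).
pose E : R := Y%:R `^ eps.
have E1 : 1 <= E by rewrite -(powRr0 (Y%:R : R)) ler_powR// ltW.
have A1_1 : 1 <= A1 by rewrite -(powRr0 (Y%:R : R)) ler_powR// divr_ge0// ltW.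
have A2_0 : 0 <= A2 := powR_ge0 _ _.
have Yn0 : (Y%:R : R) != 0 by rewrite gt_eqF.
have yk : y ^+ k = A1 by rewrite -powR_mulrn// -powRrM; congr (_ `^ _); ring.
have zk : (z ^ k)%:R <= A1 by rewrite natrX -yk lerXn2r ?nnegrE.
(* Here [Y = y ^ (2 k - 1) = A1 * y ^ (k - 1)] and [y <= 2 z]. *)
have z2 : Y%:R / z%:R ^+ k.-1 <= 2 ^+ k.-1 * A1.
  rewrite ler_pdivrMr ?exprn_gt0// mulrAC -exprMn.
  have -> : Y%:R = A1 * y ^+ k.-1.
    rewrite -powR_mulrn// -powRrM -powRD ?Yn0 ?implybT//.
    rewrite -[LHS]powRr1//; congr (_ `^ _); rewrite -subn1 natrB ?(ltnW k2)//.
    by field; rewrite gt_eqF.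
  rewrite mulrC ler_pM2r ?(lt_le_trans ltr01)// lerXn2r ?nnegrE ?mulr_ge0//.
  rewrite -natr1 in yz; have : 1 <= z%:R :> R by rewrite ler1n.
  lra.
(* This choice makes [Y / H] and [H ^ th] both equal to [A2]. *)
pose H : R := Y%:R `^ (1 / (th + 1)).
have H0 : 0 < H by rewrite powR_gt0.
have t1 : th + 1 != 0 by rewrite gt_eqF// ltr_wpDl.
have YH : Y%:R / H = A2.
  by rewrite /A2 powRB ?Yn0 ?implybT// powRr1.
have Hth : H `^ th = A2.
  by rewrite /H -powRrM /A2; congr (_ `^ _); field.
pose e : R := Y%:R `^ (eps / 4).
have e1 : 1 <= e by rewrite -(powRr0 (Y%:R : R)) ler_powR// ltW.
have eE : e ^+ 4 = E by rewrite -powR_mulrn ?powR_ge0// -powRrM; congr (_ `^ _); field.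
have TY l : (0 < l <= Y)%N -> (size (divisors l))%:R <= CT * e.
  move=> /andP[l0 lY]; apply: (le_trans (TP l l0)); rewrite ler_pM2l//.
  by rewrite ge0_ler_powR ?nnegrE ?(ltW e4)// ler_nat.
have IY := IP Y Y0; rewrite -/e in IY.
have Iz : (trunc_log 2 z).+1%:R <= CI * e.
  by apply: le_trans IY; rewrite ler_nat ltnS leq_trunc_log.
have gapb := sum_floor_gap c0 th0 cg Y0 (ltnW k2) z0 H0 TY
  (fun d => beta / alpha - (d ^ k)%:R / alpha)
  (fun d => (beta - 1) / alpha - (d ^ k)%:R / alpha).
have zb := sum_kfree_hit (z := z) (Y := Y); rewrite z0 zY in zb.
apply: (le_trans (zb isT)) => {zb}; rewrite YH Hth KE in gapb.
have ic : 0 < c^-1 by rewrite invr_gt0.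
have A10 : 0 <= A1 := le_trans ler01 A1_1.
have W_le : A2 + (z ^ k)%:R + A2 / c <= (1 + c^-1) * (A1 + A2).
  have : 0 <= c^-1 * A1 by rewrite mulr_ge0// ltW.
  have -> : (1 + c^-1) * (A1 + A2) = A1 + c^-1 * A1 + A2 + A2 / c by ring.
  lra.
have b1 : K * (CT * e) * (trunc_log 2 Y).+1%:R ^+ 3 * (A2 + (z ^ k)%:R + A2 / c)
    <= K * CT * CI ^+ 3 * (1 + c^-1) * (E * (A1 + A2)).
  have -> : K * CT * CI ^+ 3 * (1 + c^-1) * (E * (A1 + A2)) =
    K * (CT * e) * (CI * e) ^+ 3 * ((1 + c^-1) * (A1 + A2)) by rewrite -eE; ring.
  have ee0 : 0 <= e := le_trans ler01 e1.
  have KC : 0 <= K * (CT * e) by rewrite !mulr_ge0// ltW.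
  apply: ler_pM => //; first by rewrite mulr_ge0// exprn_ge0.
    by rewrite !addr_ge0// divr_ge0// ltW.
  by rewrite ler_wpM2l// lerXn2r ?nnegrE// mulr_ge0// ltW.
have EA : A1 + A2 <= E * (A1 + A2) by rewrite ler_peMl// addr_ge0.
have b2 : z%:R <= E * (A1 + A2).
  apply: le_trans EA; apply: (@le_trans _ _ A1); last by rewrite lerDl.
  by apply: le_trans zk; rewrite ler_nat -{1}(expn1 z) leq_pexp2l// ltnW.
have b3 : Y%:R / z%:R ^+ k.-1 * (1 + 2 ^+ k.-1 * (trunc_log 2 z).+1%:R) <=
    2 ^+ k.-1 * (1 + 2 ^+ k.-1 * CI) * (E * (A1 + A2)).
  have p2 : 0 <= 2 ^+ k.-1 :> R by rewrite exprn_ge0.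
  have ee : e <= E by rewrite -eE -[leLHS]expr1 ler_weXn2l.
  have h : 1 + 2 ^+ k.-1 * (trunc_log 2 z).+1%:R <= (1 + 2 ^+ k.-1 * CI) * E.
    rewrite mulrDl mul1r lerD// -mulrA ler_wpM2l//; apply: (le_trans Iz).
    by rewrite ler_pM2l.
  apply: (@le_trans _ _ (2 ^+ k.-1 * A1 * ((1 + 2 ^+ k.-1 * CI) * E))).
    by apply: ler_pM => //; rewrite ?divr_ge0 ?exprn_ge0// addr_ge0// mulr_ge0.
  have -> : 2 ^+ k.-1 * A1 * ((1 + 2 ^+ k.-1 * CI) * E) =
    2 ^+ k.-1 * (1 + 2 ^+ k.-1 * CI) * (E * A1) by ring.
  apply: ler_wpM2l; last by rewrite ler_wpM2l ?(le_trans ler01)// lerDl.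
  by rewrite mulr_ge0// addr_ge0// mulr_ge0// ltW.
have -> : Y%:R `^ (k%:R / (2 * k%:R - 1) + eps) + Y%:R `^ (1 - 1 / (th + 1) + eps)
    = E * (A1 + A2).
  by rewrite ![_ `^ (_ + eps)]powRD ?Yn0 ?implybT// -/A1 -/A2 -/E -mulrDl mulrC.
by move: (le_trans gapb b1) b2 b3; rewrite !mulrDl mul1r; clear; lra.
Qed.

End Beatty.

(** * From sums over values to sums over indices *)

Lemma beatty_kfree_count (R : realType) (k : nat) (alpha beta c th eps : R) :
  (2 <= k)%N -> 1 < alpha -> 0 < c -> 0 <= th -> 0 < eps ->
  (forall l, (0 < l)%N -> c * l%:R `^ (- th) <= dint (l%:R * alpha^-1)) ->
  exists2 C : R, 0 < C & forall x : R, 1 <= x ->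
    `| \sum_(1 <= n < (Num.truncn x).+1 |
              Num.floor (alpha * n%:R + beta) \in kfree k) 1
       - x / zeta (k%:R : R) |
    <= C * (x `^ (k%:R / (2 * k%:R - 1) + eps)
            + x `^ (1 - 1 / (th + 1) + eps)).
Proof.
move=> k2 a1 c0 th0 eps0 cg; have a0 : 0 < alpha := lt_trans ltr01 a1.
have [C C0 CP] := sum_kfree_hit_powR beta a1 k2 c0 th0 eps0 cg.
set e1 := k%:R / (2 * k%:R - 1) + eps in CP *.
set e2 := 1 - 1 / (th + 1) + eps in CP *.
have k1 : 2 <= k%:R :> R by rewrite ler_nat.
have e1_0 : 0 <= e1 by rewrite addr_ge0 ?(ltW eps0)// divr_ge0//; lra.
have e2_0 : 0 <= e2.
  rewrite addr_ge0 ?(ltW eps0)// subr_ge0 ler_pdivrMr; lra.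
have Z1 := zeta_ge1 R k2; set Z := zeta _ in CP Z1 *.
have Z0 : 0 < Z := lt_le_trans ltr01 Z1.
(* Beyond [n0] all values are at least 1, so floor and truncation agree. The earlier indices, and
   the values up to [y n0.+1], contribute at most the constants [n0.+1] and [B]. *)
pose n0 := Num.truncn (`|beta| + 1); pose y (n : nat) := alpha * n%:R + beta.
have y_n0 : 1 <= y n0.+1.
  have := truncnS_gt (`|beta| + 1); rewrite -/n0 => h.
  have : n0.+1%:R <= alpha * n0.+1%:R by rewrite ler_peMl// ltW.
  have := ler_norm (- beta); rewrite normrN /y; lra.
have y_ge1 n : (n0 < n)%N -> 1 <= y n.
  by move=> nn; apply: (le_trans y_n0); rewrite lerD2r ler_pM2l// ler_nat.
pose f (n : nat) : R := (Num.floor (y n) \in kfree k)%:R.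
have f01 n : 0 <= f n <= 1 by rewrite /f; case: (_ \in _); rewrite ?lexx ?ler01.
have fE n : (n0 < n)%N -> f n = kfreeR R k (Num.truncn (y n)).
  by move=> nn; rewrite /f /kfreeR floor_truncn// (le_trans ler01)// y_ge1.
pose S N : R := \sum_(1 <= n < N.+1) f n.
have S_bound N : 0 <= S N <= N%:R.
  rewrite sumr_ge0 => [|n _]; last by case/andP: (f01 n).
  have -> : N%:R = \sum_(1 <= n < N.+1) 1 :> R by rewrite sumr_const_nat subSS subn0.
  by apply: ler_sum => n _; case/andP: (f01 n).
pose B : R := `|\sum_(1 <= l < (Num.truncn (y n0.+1)).+1) kfreeR R k l * (hit alpha beta l)%:~R|.
pose K := alpha + `|beta|.
have K0 : 0 < K by rewrite ltr_wpDr.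
have split_S N : (n0 < N)%N -> `|S N - \sum_(1 <= l < (Num.truncn (y N)).+1)
     kfreeR R k l * (hit alpha beta l)%:~R| <= n0.+1%:R + B.
  move=> nN; rewrite /S (@big_cat_nat _ _ _ n0.+2)//=.
  rewrite [X in _ - X](@big_cat_nat _ _ _ (Num.truncn (y n0.+1)).+1)//=; last first.
    by rewrite ltnS le_truncn// lerD2r ler_pM2l// ler_nat.
  have -> : \sum_(n0.+2 <= n < N.+1) f n = \sum_((Num.truncn (y n0.+1)).+1 <= l <
          (Num.truncn (y N)).+1) kfreeR R k l * (hit alpha beta l)%:~R.
    rewrite -(sum_hit a1 _ (le_trans ler01 y_n0) nN); apply: eq_big_nat => n /andP[nn _].
    by rewrite fE// ltnW.
  rewrite opprD addrACA subrr addr0; apply: (le_trans (ler_normB _ _)); rewrite lerD//.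
  by have /andP[s0 s1] := S_bound n0.+1; rewrite ger0_norm.
exists (C * (K `^ e1 + K `^ e2) + n0.+1%:R * 2 + B + 3 + `|beta|).
  have := powR_ge0 K e1; have := powR_ge0 K e2; have := normr_ge0 beta.
  have : 0 <= B by exact: normr_ge0.
  have : 0 <= n0.+1%:R :> R by [].
  have : 0 <= C * (K `^ e1 + K `^ e2) by rewrite mulr_ge0 ?addr_ge0 ?powR_ge0 ?ltW.
  lra.
move=> x x1; have x0 : 0 < x := lt_le_trans ltr01 x1.
pose N := Num.truncn x; have /andP[Nx xN] := truncn_itv (ltW x0).
rewrite -/N in Nx xN *; rewrite big_mkcond.
have -> : \sum_(1 <= n < N.+1) (if Num.floor (alpha * n%:R + beta) \in kfree k then 1 else 0)
    = S N.
  by apply: eq_bigr => n _; rewrite /f /y; case: (_ \in _).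
have X1 : 1 <= x `^ e1 by rewrite -(powRr0 x) ler_powR.
have X2 : 0 <= x `^ e2 := powR_ge0 _ _.
set X := x `^ e1 + x `^ e2; have XX : 1 <= X by rewrite /X; lra.
have B0 : 0 <= B := normr_ge0 _.
have nb : 0 <= `|beta| := normr_ge0 _.
have n0R : 0 <= n0.+1%:R :> R by [].
have CK0 : 0 <= C * (K `^ e1 + K `^ e2).
  by rewrite mulr_ge0 ?addr_ge0 ?powR_ge0 ?ltW.
have iZ1 : Z^-1 <= 1 by rewrite invf_le1.
have iZ0 : 0 < Z^-1 by rewrite invr_gt0.
case: (leqP N n0) => Nn0.
  have /andP[s0 s1] := S_bound N.
  have xn0 : x <= n0.+1%:R by apply: (le_trans (ltW xN)); rewrite ler_nat.
  have xZ : 0 <= x / Z <= n0.+1%:R.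
    rewrite divr_ge0 ?(ltW x0) ?(ltW Z0)//= ler_pdivrMr//.
    by apply: (le_trans xn0); rewrite ler_peMr.
  have NN : N%:R <= n0.+1%:R :> R by rewrite ler_nat ltnW.
  apply: (@le_trans _ _ (n0.+1%:R * 2)).
    by move: xZ s0 s1 NN; rewrite ler_norml; clear; lra.
  apply: (@le_trans _ _ (n0.+1%:R * 2 * X)); first by rewrite ler_peMr// mulr_ge0.
  by rewrite ler_wpM2r ?(le_trans ler01)//; move: CK0 B0 nb; clear; lra.
pose Y := Num.truncn (y N).
have yN1 := y_ge1 N Nn0; have yN0 : 0 <= y N := le_trans ler01 yN1.
have Y0 : (0 < Y)%N by rewrite truncn_gt0.
have /andP[Yy yY] := truncn_itv yN0; rewrite -/Y in Yy yY.
have YK : Y%:R <= K * x.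
  apply: (le_trans Yy); rewrite /y /K mulrDl lerD ?ler_pM2l//.
  by apply: (le_trans (ler_norm _)); rewrite ler_peMr.
have YKe e : 0 <= e -> Y%:R `^ e <= K `^ e * x `^ e.
  move=> e0; rewrite -powRM ?(ltW K0) ?(ltW x0)//.
  by rewrite ge0_ler_powR ?nnegrE ?mulr_ge0 ?(ltW K0) ?(ltW x0).
have YX : C * (Y%:R `^ e1 + Y%:R `^ e2) <= C * (K `^ e1 + K `^ e2) * X.
  rewrite -mulrA ler_pM2l// /X.
  have := YKe e1 e1_0; have := YKe e2 e2_0.
  have : 0 <= K `^ e1 * x `^ e2 by rewrite mulr_ge0 ?powR_ge0.
  have : 0 <= K `^ e2 * x `^ e1 by rewrite mulr_ge0 ?powR_ge0.
  by rewrite mulrDl !mulrDr; clear; lra.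
(* Two roundings, of [x] to [N] and of [y N] to [Y], cost at most 1 each after division by
   [alpha > 1]; the offset costs at most [|beta|]. *)
have Yx : `|Y%:R / alpha / Z - x / Z| <= 2 + `|beta|.
  rewrite -mulrBl normrM (gtr0_norm iZ0) -[leRHS]mulr1.
  apply: ler_pM => //; first by rewrite ltW.
  have -> : Y%:R / alpha - x = (Y%:R - alpha * x) / alpha by field; rewrite gt_eqF.
  rewrite normrM normfV (gtr0_norm a0) ler_pdivrMr//.
  have aN : alpha * N%:R <= alpha * x by rewrite ler_pM2l.
  have aN' : alpha * x <= alpha * N%:R + alpha.
    by rewrite -{3}[alpha]mulr1 -mulrDr natr1 ler_pM2l// ltW.
  have bb : `|beta| <= `|beta| * alpha by rewrite ler_peMr// ltW.
  have := ler_norm beta; have := ler_norm (- beta); rewrite normrN.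
  move: yY; rewrite -natr1 /y in Yy *; rewrite ler_norml => yY b1 b2.
  by move: yY Yy b1 b2 aN aN' bb a1; clear; lra.
have := split_S N Nn0; rewrite -/Y; set A := \sum_(1 <= l < Y.+1) _ => SA.
have := CP Y Y0; rewrite -/A => AY.
have tri : `|S N - x / Z| <= `|S N - A| + `|A - Y%:R / alpha / Z| + `|Y%:R / alpha / Z - x / Z|.
  have -> : S N - x / Z = (S N - A) + (A - Y%:R / alpha / Z) + (Y%:R / alpha / Z - x / Z) by ring.
  apply: (le_trans (ler_normD _ _)); rewrite lerD2r; exact: ler_normD.
have : (n0.+1%:R + B + 2 + `|beta|) <= (n0.+1%:R * 2 + B + 3 + `|beta|) * X.
  apply: (@le_trans _ _ (n0.+1%:R * 2 + B + 3 + `|beta|)); first by move: n0R; clear; lra.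
  by rewrite ler_peMr//; move: n0R B0 nb; clear; lra.
set U := n0.+1%:R * 2 + B + 3 + `|beta| => hU.
have -> : C * (K `^ e1 + K `^ e2) + n0.+1%:R * 2 + B + 3 + `|beta| = C * (K `^ e1 + K `^ e2) + U.
  by rewrite /U !addrA.
by rewrite mulrDl; move: (le_trans AY YX) Yx hU tri SA; clear; lra.
Qed.

Theorem corollary1p2 (R : realType) (k : nat) (hk : (2 <= k)%N)
    (alpha : R) (halpha1 : 1 < alpha) (halpha : irrational alpha)
    (tau : R) (htau : irr_type alpha = tau%:E)
    (beta : R) (eps : R) (heps : 0 < eps) :
  exists2 C : R, 0 < C & forall x : R, 1 <= x ->
    `| \sum_(1 <= n < (Num.truncn x).+1 |
              Num.floor (alpha * n%:R + beta) \in kfree k) 1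
       - x / zeta (k%:R : R) |
    <= C * (x `^ (k%:R / (2 * k%:R - 1) + eps)
            + x `^ (1 - 1 / (tau + 1) + eps)).
Proof.
have tau0 := irr_type_ge0 halpha htau.
have e2 : 0 < eps / 2 by rewrite divr_gt0.
(* Half of [eps] moves [th] above [tau], which changes [1 / (tau + 1)] by at most [eps / 2]; the
   other half goes to the counting bound. *)
pose th := tau + eps / 2.
have tau_th : tau < th by rewrite ltrDl.
have th0 : 0 <= th := le_trans tau0 (ltW tau_th).
have [c c0 cP] := irr_type_lower_bound halpha htau tau_th.
have [c' c'0 c'P] := dint_inv_lower_bound halpha1 c0 th0 cP.
have [C C0 CP] := beatty_kfree_count beta hk halpha1 c'0 th0 e2 c'P.
exists C => // x x1; apply: (le_trans (CP x x1)); rewrite ler_pM2l//.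
apply: lerD; apply: ler_powR => //; first by lra.
suff : (tau + 1)^-1 <= (th + 1)^-1 + eps / 2 by rewrite !div1r; lra.
have t1 : 0 < tau + 1 by lra.
have t2 : 0 < th + 1 by lra.
rewrite -lerBlDl.
have -> : (tau + 1)^-1 - (th + 1)^-1 = (th + 1 - (tau + 1)) / ((tau + 1) * (th + 1)).
  by move: (tau + 1) (th + 1) t1 t2 => a b a0 b0; field; rewrite !gt_eqF.
have -> : th + 1 - (tau + 1) = eps / 2 by rewrite /th; ring.
rewrite ler_pdivrMr ?mulr_gt0// ler_peMr ?(ltW e2)//.
by rewrite -[leLHS]mulr1 ler_pM//; lra.
Qed.
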